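(* The problem $$\frac{\partial^\gamma v_\alpha}{\partial t^\gamma}+A_\alpha v_\alpha=0,\quad 0<t<T,\qquad v_\alpha(T)=f,$$ admits a unique solution $$v_\alpha(t)=\sum_{n=1}^\infty\frac{E_{\gamma,1}(-\lambda_{\alpha n}t^\gamma)\,\langle f,\phi_n\rangle\phi_n}{E_{\gamma,1}(-\lambda_{\alpha n}T^\gamma)},\quad\forall t\in[0,T],$$ where $\lambda_{\alpha n}=\frac{\lambda_n}{1+\alpha\lambda_n^b}$. Furthermore, there exists a constant $\overline C_6$ such that $$\|v_\alpha(t)\|\le\overline C_6\left(1+\alpha^{-\frac1b}\right)\|f\|,\quad\forall t\in[0,T].$$
   Context: Fix $\gamma\in(0,1)$, $T>0$, a real number $b\ge1$ and a regularization parameter $\alpha>0$. $\mathbb H$ is a Hilbert space with inner product $\langle\cdot,\cdot\rangle$ and norm $\|\cdot\|$, and $f\in\mathbb H$. $A:D(A)\subset\mathbb H\to\mathbb H$ is a self-adjoint closed operator such that $-A$ generates a compact contraction semigroup on $\mathbb H$, and $A$ admits an orthonormal eigenbasis $\{\phi_n\}_{n\ge1}$ of $\mathbb H$ associated with eigenvalues $\{\lambda_n\}_{n\ge1}$, where $0<\lambda_1<\lambda_2<\cdots$ and $\lambda_n\to+\infty$. The Caputo derivative is $\frac{\partial^\gamma u}{\partial t^\gamma}(t)=\frac{1}{\Gamma(1-\gamma)}\int_0^t(t-s)^{-\gamma}\frac{\partial u}{\partial s}(s)\,ds$. The Mittag-Leffler function is $E_{\gamma,\beta}(z)=\sum_{k=0}^\infty\frac{z^k}{\Gamma(k\gamma+\beta)}$.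 $A^bv=\sum_{n\ge1}\lambda_n^b\langle v,\phi_n\rangle\phi_n$ for $v\in D(A^b)=\{v\in\mathbb H:\sum_{n\ge1}\lambda_n^{2b}\langle v,\phi_n\rangle^2<\infty\}$, and $A_\alpha v=(I+\alpha A^b)^{-1}Av=\sum_{n\ge1}\frac{\lambda_n}{1+\alpha\lambda_n^b}\langle v,\phi_n\rangle\phi_n$. A solution of the final value problem is a function $v\in C^1((0,T),\mathbb H)\cap C([0,T],\mathbb H)$ with $v(t)\in D(A_\alpha)$ for all $t\in(0,T)$ that satisfies the equation and the condition at $t=T$. *)

(* Defs.v *)
From Stdlib Require Import Reals.
From Coquelicot Require Import Coquelicot.

Set Implicit Arguments.
Unset Strict Implicit.

Open Scope R_scope.

(* [Rpower 0 y = 1] in the standard library; here the value at [0] is [0], as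
   it should be for [y > 0]. *)
Definition rpow (x y : R) : R := if Rlt_dec 0 x then Rpower x y else 0.

(* Euler's integral; meaningful for [0 < x]. *)
Definition Gamma (x : R) : R :=
  RInt_gen (fun t => Rpower t (x - 1) * exp (- t))
    (at_right 0) (Rbar_locally p_infty).

Definition mittag_leffler (gamma beta z : R) : R :=
  PSeries (fun k => / Gamma (INR k * gamma + beta)) z.

(* A real Hilbert space is a complete normed space whose norm comes from an
   inner product. *)
Record is_inner_product (H : CompleteNormedModule R_AbsRing)
    (inner : H -> H -> R) : Prop := {
  inner_sym : forall x y, inner x y = inner y x;
  inner_plus_l : forall x y z, inner (plus x y) z = inner x z + inner y z;
  inner_scal_l : forall (a : R) x y, inner (scal a x) y = a * inner x y;
  inner_norm : forall x, norm x = sqrt (inner x x);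
  inner_pos : forall x, 0 <= inner x x
}.

Definition is_orthonormal_basis (H : CompleteNormedModule R_AbsRing)
    (inner : H -> H -> R) (phi : nat -> H) : Prop :=
  (forall n, inner (phi n) (phi n) = 1) /\
  (forall m n, m <> n -> inner (phi m) (phi n) = 0) /\
  (forall x, is_series (fun n => scal (inner x (phi n)) (phi n)) x).

(* An operator with domain [D] is given by a total function [A], whose values
   outside [D] are irrelevant. *)
Definition is_operator (H : CompleteNormedModule R_AbsRing)
    (D : H -> Prop) (A : H -> H) : Prop :=
  D zero /\
  (forall x y, D x -> D y -> D (plus x y) /\ A (plus x y) = plus (A x) (A y)) /\
  (forall (a : R) x, D x -> D (scal a x) /\ A (scal a x) = scal a (A x)).

Definition is_closed_operator (H : CompleteNormedModule R_AbsRing)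
    (D : H -> Prop) (A : H -> H) : Prop :=
  forall (u : nat -> H) (x y : H), (forall n, D (u n)) ->
    filterlim u eventually (locally x) ->
    filterlim (fun n => A (u n)) eventually (locally y) ->
    D x /\ A x = y.

(* The left-hand side of the equivalence says that [y] is in the domain of the
   adjoint, with value [z]; density makes [z] unique. *)
Definition is_self_adjoint (H : CompleteNormedModule R_AbsRing)
    (inner : H -> H -> R) (D : H -> Prop) (A : H -> H) : Prop :=
  (forall (x : H) (eps : posreal), exists y, D y /\ norm (minus x y) < eps) /\
  (forall y z, (forall x, D x -> inner (A x) y = inner x z) <-> (D y /\ A y = z)).

Definition is_C0_semigroup (H : CompleteNormedModule R_AbsRing)
    (S : R -> H -> H) : Prop :=
  (forall t, 0 <= t -> is_linear (S t)) /\
  (forall x, S 0 x = x) /\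
  (forall s t x, 0 <= s -> 0 <= t -> S (s + t) x = S s (S t x)) /\
  (forall x, filterlim (fun t => S t x) (at_right 0) (locally x)).

Definition is_contraction_semigroup (H : CompleteNormedModule R_AbsRing)
    (S : R -> H -> H) : Prop :=
  forall t x, 0 <= t -> norm (S t x) <= norm x.

Definition is_compact_map (H : CompleteNormedModule R_AbsRing)
    (K : H -> H) : Prop :=
  forall u : nat -> H, (exists M, forall n, norm (u n) <= M) ->
    exists (k : nat -> nat) (y : H), (forall n, (k n < k (S n))%nat) /\
      filterlim (fun n => K (u (k n))) eventually (locally y).

Definition is_compact_semigroup (H : CompleteNormedModule R_AbsRing)
    (S : R -> H -> H) : Prop :=
  forall t, 0 < t -> is_compact_map (S t).

Definition is_generator (H : CompleteNormedModule R_AbsRing)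
    (S : R -> H -> H) (D : H -> Prop) (B : H -> H) : Prop :=
  forall x y, (D x /\ B x = y) <->
    filterlim (fun h => scal (/ h) (minus (S h x) x)) (at_right 0) (locally y).

Definition diag_dom (H : CompleteNormedModule R_AbsRing)
    (inner : H -> H -> R) (phi : nat -> H) (mu : nat -> R) (v : H) : Prop :=
  ex_series (fun n => (mu n) ^ 2 * (inner v (phi n)) ^ 2).

Definition is_diag (H : CompleteNormedModule R_AbsRing)
    (inner : H -> H -> R) (phi : nat -> H) (mu : nat -> R) (v w : H) : Prop :=
  is_series (fun n => scal (mu n * inner v (phi n)) (phi n)) w.

(* Symbol of [(I + alpha A^b)^-1 A].  For [1 <= b] it is bounded, so the
   operator is the bounded extension of this product to the whole space. *)
Definition lambda_alpha (lambda : nat -> R) (b alpha : R) (n : nat) : R :=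
  lambda n / (1 + alpha * Rpower (lambda n) b).

(* For [f] continuous on the open interval [(a, b)] this is the Bochner
   integral: Bochner integrability then amounts to convergence of the improper
   integral of the norm. *)
Definition is_integral_open (V : NormedModule R_AbsRing)
    (f : R -> V) (a b : R) (l : V) : Prop :=
  ex_RInt_gen (fun s => norm (f s)) (at_right a) (at_left b) /\
  is_RInt_gen f (at_right a) (at_left b) l.

Definition is_C1_open (V : NormedModule R_AbsRing)
    (a b : R) (v dv : R -> V) : Prop :=
  forall t, a < t < b -> is_derive v t (dv t) /\ continuous dv t.

(* [dv] is the derivative of the function whose Caputo derivative at [t] is
   [d]. *)
Definition is_caputo (V : NormedModule R_AbsRing)
    (gamma : R) (dv : R -> V) (t : R) (d : V) : Prop :=
  exists l : V,
    is_integral_open (fun s => scal (Rpower (t - s) (- gamma)) (dv s)) 0 t l /\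
    d = scal (/ Gamma (1 - gamma)) l.

Definition is_solution (H : CompleteNormedModule R_AbsRing)
    (inner : H -> H -> R) (phi : nat -> H) (lambda : nat -> R)
    (gamma T b alpha : R) (f : H) (v : R -> H) : Prop :=
  continuous_on (fun t => 0 <= t <= T) v /\
  (exists dv : R -> H, is_C1_open 0 T v dv /\
    forall t, 0 < t < T ->
      diag_dom inner phi (lambda_alpha lambda b alpha) (v t) /\
      exists d w : H,
        is_caputo gamma dv t d /\
        is_diag inner phi (lambda_alpha lambda b alpha) (v t) w /\
        plus d w = zero) /\
  v T = f.

(* Main.v *)
(** Since [lambda_alpha] is bounded by [M = alpha^(-1/b)], [A_alpha] is a bounded
   operator and [v t = sum_k t^(k gamma) / Gamma (k gamma + 1) (- A_alpha)^k v0]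
   converges in norm; the beta integral identifies the Caputo derivative of each
   term, and [v0] is chosen so that [v T = f].  Everything else rests on the
   extremum principle: at a maximum [t] of [z] over [[0, t]], integration by parts
   gives [int_0^t (t - s)^(-gamma) z'(s) ds >= t^(-gamma) (z t - z 0)].  Applied to
   the scalar equation [d^gamma z + mu z = 0] it yields uniqueness of the initial
   value problem and [1 / (1 + mu Gamma(1 - gamma) t^gamma) <= E_gamma(- mu t^gamma) <= 1];
   the quotient of Mittag-Leffler values is therefore at most
   [1 + M Gamma(1 - gamma) T^gamma], which is the stability estimate. *)
Require Import Defs.
From Stdlib Require Import Reals Lra Lia.
From Coquelicot Require Import Coquelicot.
Open Scope R_scope.

(** * Improper integrals *)

(** Boundedness of [A_alpha] is what permits a power series in [t^gamma]: differentiability in norm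
    then follows from termwise estimates, whereas a construction along the eigenbasis would need
    control of the derivatives of infinitely many scalar functions at once. The derivative still
    behaves like [t^(gamma - 1)] near 0 while the Caputo kernel blows up at the other end, so every
    integral is improper on both sides; this is why integration is developed over abstract intervals
    with two end filters. The beta integral is evaluated without double integrals. As a function of
    [x] it obeys the same recurrence as [Gamma x * Gamma y / Gamma (x + y)] and has the same
    asymptotics at infinity, in the spirit of Bohr and Mollerup. The final condition fixes the
    initial value through [z T = z 0 * E T] in each eigendirection. The lower bound on [E T]
    therefore serves three times: it makes the initial value a vector of [H], it makes the initial
    value unique, and it gives the stability constant. *)

Lemma norm_minus_triangle {V : NormedModule R_AbsRing} (x y z : V) :
  norm (minus x z) <= norm (minus x y) + norm (minus y z).
Proof. rewrite (minus_trans y x z). apply norm_triangle. Qed.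

(** One interface for [(0, t)] and [(0, +oo)], so that the Gamma integral and the Caputo integrals
    share a single theory. The last two fields say that the subintervals cut out by the two filters
    exhaust [I]. *)
Record improper_interval (I : R -> Prop) (Fa Fb : (R -> Prop) -> Prop) : Prop := {
  ii_left_proper : ProperFilter Fa;
  ii_right_proper : ProperFilter Fb;
  ii_convex : forall x y z, I x -> I y -> x <= z <= y -> I z;
  ii_left : Fa I;
  ii_right : Fb I;
  ii_left_le : forall p, I p -> Fa (fun a => a <= p);
  ii_right_le : forall p, I p -> Fb (fun b => p <= b)
}.

Arguments ii_left_proper {I Fa Fb}.
Arguments ii_right_proper {I Fa Fb}.
Arguments ii_convex {I Fa Fb}.
Arguments ii_left {I Fa Fb}.
Arguments ii_right {I Fa Fb}.
Arguments ii_left_le {I Fa Fb}.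
Arguments ii_right_le {I Fa Fb}.

Lemma improper_interval_bounded (a b : R) :
  a < b -> improper_interval (fun s => a < s < b) (at_right a) (at_left b).
Proof.
intros hab.
assert (hl : forall p, a < p -> at_right a (fun x => a < x < p)).
{ intros p hp. exists (mkposreal (p - a) ltac:(lra)). intros y hy hay.
  apply Rabs_def2 in hy. cbn in hy. unfold minus, plus, opp in hy. cbn in hy. lra. }
assert (hr : forall p, p < b -> at_left b (fun x => p < x < b)).
{ intros p hp. exists (mkposreal (b - p) ltac:(lra)). intros y hy hay.
  apply Rabs_def2 in hy. cbn in hy. unfold minus, plus, opp in hy. cbn in hy. lra. }
split.
- apply at_right_proper_filter.
- apply at_left_proper_filter.
- intros; lra.
- apply hl, hab.
- apply hr, hab.
- intros p hp. generalize (hl p (proj1 hp)). apply filter_imp. intros; lra.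
- intros p hp. generalize (hr p (proj2 hp)). apply filter_imp. intros; lra.
Qed.

Lemma improper_interval_pos :
  improper_interval (fun s => 0 < s) (at_right 0) (Rbar_locally p_infty).
Proof.
assert (hl : forall p, 0 < p -> at_right 0 (fun x => 0 < x < p)).
{ intros p hp. exists (mkposreal p hp). intros y hy hay.
  apply Rabs_def2 in hy. cbn in hy. unfold minus, plus, opp in hy. cbn in hy. lra. }
split.
- apply at_right_proper_filter.
- apply Rbar_locally_filter.
- intros; lra.
- generalize (hl 1 Rlt_0_1). apply filter_imp. intros; lra.
- exists 0. auto.
- intros p hp. generalize (hl p hp). apply filter_imp. intros; lra.
- intros p hp. exists p. intros; lra.
Qed.

Section Improper.

Context {I : R -> Prop} {Fa Fb : (R -> Prop) -> Prop}.
Hypothesis HI : improper_interval I Fa Fb.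

Let PFa : ProperFilter Fa := ii_left_proper HI.
Let PFb : ProperFilter Fb := ii_right_proper HI.
#[local] Existing Instance PFa.
#[local] Existing Instance PFb.

Lemma ii_inhabited : exists p, I p.
Proof. apply (filter_ex (F := Fa)), (ii_left HI). Qed.

Lemma ii_eventually :
  filter_prod Fa Fb (fun ab => I (fst ab) /\ I (snd ab) /\ fst ab <= snd ab).
Proof.
destruct ii_inhabited as [p hp].
exists (fun a => I a /\ a <= p) (fun b => I b /\ p <= b).
- apply filter_and; [apply (ii_left HI) | apply (ii_left_le HI), hp].
- apply filter_and; [apply (ii_right HI) | apply (ii_right_le HI), hp].
- intros x y [h1 h2] [h3 h4]. cbn. repeat split; auto; lra.
Qed.

Lemma ii_ex_RInt {V : CompleteNormedModule R_AbsRing} (f : R -> V) :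
  (forall x, I x -> continuous f x) -> forall a b, I a -> I b -> ex_RInt f a b.
Proof.
intros hf a b ha hb. apply (ex_RInt_continuous (V := V)). intros z hz. apply hf.
unfold Rmin, Rmax in hz. destruct (Rle_dec a b).
- apply (ii_convex HI) with a b; auto.
- apply (ii_convex HI) with b a; auto.
Qed.

(** Continuity makes all proper integrals inside [I] exist, so the relational limit in [is_RInt_gen]
    becomes the limit of an honest function, to which the filter lemmas apply. *)
Lemma is_RInt_gen_filterlim {V : CompleteNormedModule R_AbsRing} (f : R -> V) l :
  (forall x, I x -> continuous f x) ->
  is_RInt_gen f Fa Fb l <->
  filterlim (fun ab => RInt f (fst ab) (snd ab)) (filter_prod Fa Fb) (locally l).
Proof.
intros hf. split.
- intros h P hP. specialize (h P hP). unfold filtermapi in h. unfold filtermap.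
  generalize h. apply filter_imp. intros ab [y [h1 h2]].
  rewrite (is_RInt_unique _ _ _ _ h1). exact h2.
- intros h P hP. specialize (h P hP). unfold filtermap in h. unfold filtermapi.
  generalize (filter_and _ _ h ii_eventually). apply filter_imp.
  intros ab [h1 [h2 [h3 h4]]]. exists (RInt f (fst ab) (snd ab)). split; auto.
  apply (RInt_correct (V := V)), ii_ex_RInt; auto.
Qed.

Section Nonneg.

Variable f : R -> R.
Hypothesis cf : forall x, I x -> continuous f x.
Hypothesis pf : forall x, I x -> 0 <= f x.

Lemma RInt_nonneg_monotone a a' b' b :
  I a -> I b -> a <= a' -> a' <= b' -> b' <= b -> RInt f a' b' <= RInt f a b.
Proof.
intros ha hb h1 h2 h3.
assert (ha' : I a') by (apply (ii_convex HI) with a b; auto; lra).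
assert (hb' : I b') by (apply (ii_convex HI) with a b; auto; lra).
assert (e := @ii_ex_RInt R_CompleteNormedModule f cf).
rewrite <- (RInt_Chasles (V := R_CompleteNormedModule) f a a' b); auto.
rewrite <- (RInt_Chasles (V := R_CompleteNormedModule) f a' b' b); auto.
change (RInt f a' b' <= RInt f a a' + (RInt f a' b' + RInt f b' b)).
assert (0 <= RInt f a a').
{ apply RInt_ge_0; auto. intros x hx. apply pf, (ii_convex HI) with a a'; auto; lra. }
assert (0 <= RInt f b' b).
{ apply RInt_ge_0; auto. intros x hx. apply pf, (ii_convex HI) with b' b; auto; lra. }
lra.
Qed.

(** The improper integral is the supremum of the proper ones: once some subinterval comes within
    [eps] of it, every larger subinterval does too, by monotonicity. *)
Lemma is_RInt_gen_nonneg_bounded M :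
  (forall a b, I a -> I b -> a <= b -> RInt f a b <= M) ->
  exists l, is_RInt_gen f Fa Fb l /\ l <= M.
Proof.
intros hM.
destruct ii_inhabited as [p hp].
destruct (completeness (fun y => exists a b, I a /\ I b /\ a <= b /\ y = RInt f a b))
  as [l [hub hlub]].
- exists M. intros y [a [b [h1 [h2 [h3 ->]]]]]. auto.
- exists (RInt f p p), p, p. repeat split; auto; lra.
- exists l. split.
  + apply (is_RInt_gen_filterlim (V := R_CompleteNormedModule) f); auto.
    apply filterlim_locally. intros eps.
    assert (exists a0 b0, I a0 /\ I b0 /\ a0 <= b0 /\ l - eps < RInt f a0 b0)
      as [a0 [b0 [h1 [h2 [h3 h4]]]]].
    { apply Classical_Prop.NNPP. intros hn.
      assert (hle : l <= l - eps).
      { apply hlub. intros y [a [b [h1 [h2 [h3 ->]]]]]. apply Rnot_lt_le. intros h4.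
        apply hn. exists a, b. auto. }
      destruct eps as [e he]. cbn in hle. lra. }
    exists (fun a => I a /\ a <= a0) (fun b => I b /\ b0 <= b).
    * apply filter_and; [apply (ii_left HI) | apply (ii_left_le HI), h1].
    * apply filter_and; [apply (ii_right HI) | apply (ii_right_le HI), h2].
    * intros a b [g1 g2] [g3 g4]. cbn.
      assert (RInt f a0 b0 <= RInt f a b) by (apply RInt_nonneg_monotone; auto).
      assert (RInt f a b <= l) by (apply hub; exists a, b; repeat split; auto; lra).
      apply Rabs_def1; unfold minus, plus, opp; cbn; destruct eps as [e he]; cbn in *; lra.
  + apply hlub. intros y [a [b [h1 [h2 [h3 ->]]]]]. auto.
Qed.

Lemma RInt_le_RInt_gen l a b :
  is_RInt_gen f Fa Fb l -> I a -> I b -> a <= b -> RInt f a b <= l.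
Proof.
intros hl ha hb hab.
apply (is_RInt_gen_filterlim (V := R_CompleteNormedModule) f) in hl; auto.
refine (filterlim_le (F := filter_prod Fa Fb) (fun _ => RInt f a b) _ (RInt f a b) l _ _ hl).
- exists (fun x => I x /\ x <= a) (fun y => I y /\ b <= y).
  + apply filter_and; [apply (ii_left HI) | apply (ii_left_le HI), ha].
  + apply filter_and; [apply (ii_right HI) | apply (ii_right_le HI), hb].
  + intros x y [g1 g2] [g3 g4]. apply RInt_nonneg_monotone; auto.
- apply filterlim_const.
Qed.

End Nonneg.

Lemma is_RInt_gen_dominated (f g : R -> R) M :
  (forall x, I x -> continuous f x) -> (forall x, I x -> continuous g x) ->
  (forall x, I x -> 0 <= f x <= g x) ->
  is_RInt_gen g Fa Fb M -> exists l, is_RInt_gen f Fa Fb l /\ l <= M.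
Proof.
intros cf cg hfg hg. apply is_RInt_gen_nonneg_bounded; auto.
{ intros x hx. apply hfg, hx. }
intros a b ha hb hab.
apply Rle_trans with (RInt g a b).
- apply RInt_le; auto; try apply (ii_ex_RInt (V := R_CompleteNormedModule)); auto.
  intros x hx. apply hfg, (ii_convex HI) with a b; auto; lra.
- apply RInt_le_RInt_gen; auto. intros x hx. specialize (hfg x hx). lra.
Qed.

Lemma is_RInt_gen_le (f g : R -> R) lf lg :
  (forall x, I x -> 0 <= f x <= g x) ->
  is_RInt_gen f Fa Fb lf -> is_RInt_gen g Fa Fb lg -> lf <= lg.
Proof.
intros hfg hf hg. apply Rle_trans with (Rabs lf); [apply Rle_abs |].
apply (RInt_gen_norm (V := R_CompleteNormedModule) (Fa := Fa) (Fb := Fb) f g lf lg); auto.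
- generalize ii_eventually. apply filter_imp. tauto.
- generalize ii_eventually. apply filter_imp. intros ab [h1 [h2 h3]] x hx.
  assert (hI : I x) by (apply (ii_convex HI) with (fst ab) (snd ab); auto).
  specialize (hfg x hI). change (Rabs (f x) <= g x). rewrite Rabs_pos_eq; lra.
Qed.

Lemma is_RInt_gen_ext_on {V : CompleteNormedModule R_AbsRing} (f g : R -> V) l :
  (forall x, I x -> f x = g x) -> is_RInt_gen f Fa Fb l -> is_RInt_gen g Fa Fb l.
Proof.
intros hfg. apply is_RInt_gen_ext; try apply _.
generalize ii_eventually. apply filter_imp. intros ab [h1 [h2 h3]] x hx.
rewrite Rmin_left, Rmax_right in hx by auto.
apply hfg, (ii_convex HI) with (fst ab) (snd ab); auto; lra.
Qed.

Lemma is_RInt_gen_inj {V : CompleteNormedModule R_AbsRing} (f : R -> V) l1 l2 :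
  is_RInt_gen f Fa Fb l1 -> is_RInt_gen f Fa Fb l2 -> l1 = l2.
Proof.
intros h1 h2. rewrite <- (is_RInt_gen_unique _ _ h1). apply (is_RInt_gen_unique _ _ h2).
Qed.

Lemma is_RInt_gen_derive (f df : R -> R) (la lb : R) :
  (forall x, I x -> is_derive f x (df x)) -> (forall x, I x -> continuous df x) ->
  filterlim f Fa (locally la) -> filterlim f Fb (locally lb) ->
  is_RInt_gen df Fa Fb (lb - la).
Proof.
intros hd hc hla hlb.
apply (is_RInt_gen_filterlim (V := R_CompleteNormedModule)); auto.
apply filterlim_ext_loc with (fun ab => minus (f (snd ab)) (f (fst ab))).
- generalize ii_eventually. apply filter_imp. intros ab [h1 [h2 h3]].
  symmetry. apply (is_RInt_unique (V := R_CompleteNormedModule)).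
  apply (is_RInt_derive (V := R_CompleteNormedModule) f df).
  + intros x hx. rewrite Rmin_left, Rmax_right in hx by auto.
    apply hd, (ii_convex HI) with (fst ab) (snd ab); auto.
  + intros x hx. rewrite Rmin_left, Rmax_right in hx by auto.
    apply hc, (ii_convex HI) with (fst ab) (snd ab); auto.
- unfold minus.
  apply (filterlim_comp_2 (G := locally lb) (H := locally (opp la))).
  + apply filterlim_comp with (1 := filterlim_snd) (2 := hlb).
  + apply filterlim_comp with (G := locally la).
    * apply filterlim_comp with (1 := filterlim_fst) (2 := hla).
    * apply (filterlim_opp (V := R_NormedModule) la).
  + apply (filterlim_plus (V := R_NormedModule) lb (opp la)).
Qed.

(* Integrates a series term by term when its remainders are small relative to
   one fixed integrable function [g]. *)
Lemma is_RInt_gen_rel_unif {V : CompleteNormedModule R_AbsRing}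
    (fn : nat -> R -> V) (f : R -> V) (g : R -> R) (eps : nat -> R)
    (hn : nat -> V) (h : V) (G : R) :
  (forall n x, I x -> continuous (fn n) x) -> (forall x, I x -> continuous f x) ->
  (forall x, I x -> continuous g x) -> (forall x, I x -> 0 <= g x) ->
  is_RInt_gen g Fa Fb G ->
  (forall n x, I x -> norm (minus (f x) (fn n x)) <= eps n * g x) ->
  is_lim_seq eps 0 ->
  (forall n, is_RInt_gen (fn n) Fa Fb (hn n)) ->
  filterlim hn eventually (locally h) ->
  is_RInt_gen f Fa Fb h.
Proof.
intros cfn cf cg pg hG hle he hfn hh.
apply is_RInt_gen_filterlim; auto.
apply filterlim_locally_ball_norm. intros e.
assert (hG0 : 0 <= G).
{ destruct ii_inhabited as [p hp]. apply Rle_trans with (RInt g p p).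
  - rewrite RInt_point. apply Rle_refl.
  - apply RInt_le_RInt_gen; auto; lra. }
set (e3 := mkposreal (e / 3) ltac:(destruct e; cbn; lra)).
assert (hh' := proj1 (filterlim_locally_ball_norm _ _) hh e3).
(* The division is by [G + 1] because [G] may be 0. *)
assert (hd : 0 < e / 3 / (G + 1)).
{ apply Rdiv_lt_0_compat; [destruct e; cbn |]; lra. }
assert (he' := proj1 (filterlim_locally_ball_norm (U := R_NormedModule) _ _) he (mkposreal _ hd)).
destruct (filter_ex _ (filter_and _ _ hh' he')) as [n [h1 h2]].
assert (h3 := proj1 (is_RInt_gen_filterlim (fn n) (hn n) (cfn n)) (hfn n)).
assert (h3' := proj1 (filterlim_locally_ball_norm _ _) h3 e3).
generalize (filter_and _ _ h3' ii_eventually). apply filter_imp.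
intros [a b] [h4 [ha [hb hab]]]. cbn in ha, hb, hab, h4 |- *.
unfold ball_norm in *.
assert (h5 : norm (minus (RInt f a b) (RInt (fn n) a b)) <= eps n * RInt g a b).
{ apply (norm_RInt_le (V := V) (fun x => minus (f x) (fn n x)) (fun x => eps n * g x) a b); auto.
  - intros x hx. apply hle, (ii_convex HI) with a b; auto.
  - apply (is_RInt_minus (V := V)); apply (RInt_correct (V := V)), ii_ex_RInt; auto.
  - apply (is_RInt_scal (V := R_NormedModule)).
    apply (RInt_correct (V := R_CompleteNormedModule)).
    apply (ii_ex_RInt (V := R_CompleteNormedModule)); auto. }
assert (h6 : eps n * RInt g a b < e / 3).
{ change (Rabs (eps n - 0) < e / 3 / (G + 1)) in h2. rewrite Rminus_0_r in h2.
  assert (0 <= RInt g a b).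
  { apply RInt_ge_0; auto.
    - apply (ii_ex_RInt (V := R_CompleteNormedModule)); auto.
    - intros x hx. apply pg, (ii_convex HI) with a b; auto; lra. }
  assert (RInt g a b <= G) by (apply RInt_le_RInt_gen; auto).
  apply Rle_lt_trans with (Rabs (eps n) * RInt g a b).
  { apply Rmult_le_compat_r; auto. apply Rle_abs. }
  apply Rle_lt_trans with (Rabs (eps n) * G).
  { apply Rmult_le_compat_l; auto. apply Rabs_pos. }
  apply Rle_lt_trans with (e / 3 / (G + 1) * G).
  { apply Rmult_le_compat_r; auto. lra. }
  apply Rlt_le_trans with (e / 3 / (G + 1) * (G + 1)).
  { apply Rmult_lt_compat_l; [exact hd | lra]. }
  right. field. lra. }
change (norm (minus (RInt f a b) h) < e).
change (norm (minus (RInt (fn n) a b) (hn n)) < e / 3) in h4.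
change (norm (minus (hn n) h) < e / 3) in h1.
assert (h7 := norm_minus_triangle (V := V) (RInt f a b) (RInt (fn n) a b) h).
assert (h8 := norm_minus_triangle (V := V) (RInt (fn n) a b) (hn n) h).
assert (hR : forall a0 b0 c0 d0 e0 r : R,
  a0 <= b0 + c0 -> c0 <= d0 + e0 -> b0 < r / 3 -> d0 < r / 3 -> e0 < r / 3 -> a0 < r)
  by (intros; lra).
exact (hR _ _ _ _ _ _ h7 h8 (Rle_lt_trans _ _ _ h5 h6) h4 h1).
Qed.

End Improper.

(** * The Gamma function *)

Section Substitution.

Context {I J : R -> Prop} {Fa Fb Ga Gb : (R -> Prop) -> Prop}.
Hypothesis HI : improper_interval I Fa Fb.
Hypothesis HJ : improper_interval J Ga Gb.
Variables (f g dg : R -> R) (l : R).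
Hypothesis cf : forall x, I x -> continuous f x.
Hypothesis hg : forall y, J y -> I (g y).
Hypothesis hd : forall y, J y -> is_derive g y (dg y).
Hypothesis hc : forall y, J y -> continuous dg y.
Hypothesis hl : is_RInt_gen f Fa Fb l.

Let PFa : ProperFilter Fa := ii_left_proper HI.
Let PFb : ProperFilter Fb := ii_right_proper HI.
Let PGa : ProperFilter Ga := ii_left_proper HJ.
Let PGb : ProperFilter Gb := ii_right_proper HJ.
#[local] Existing Instance PFa.
#[local] Existing Instance PFb.
#[local] Existing Instance PGa.
#[local] Existing Instance PGb.

Let continuous_subst y : J y -> continuous (fun y => dg y * f (g y)) y.
Proof.
intros hy. apply (continuous_mult (K := R_AbsRing)); auto.
apply continuous_comp; auto. apply (ex_derive_continuous (V := R_NormedModule)).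
eexists; apply hd, hy.
Qed.

Let RInt_subst a b : J a -> J b -> a <= b ->
  RInt (fun y => dg y * f (g y)) a b = RInt f (g a) (g b).
Proof.
intros ha hb hab. apply (is_RInt_unique (V := R_CompleteNormedModule)).
assert (hJ : forall x, Rmin a b <= x <= Rmax a b -> J x).
{ intros x hx. rewrite Rmin_left, Rmax_right in hx by auto.
  apply (ii_convex HJ) with a b; auto. }
apply (is_RInt_comp (V := R_CompleteNormedModule) f g dg a b); auto.
Qed.

Lemma is_RInt_gen_subst_increasing :
  filterlim g Ga Fa -> filterlim g Gb Fb ->
  is_RInt_gen (fun y => dg y * f (g y)) Ga Gb l.
Proof.
intros ha hb.
apply (is_RInt_gen_filterlim HJ (V := R_CompleteNormedModule)); auto.
apply (is_RInt_gen_filterlim HI (V := R_CompleteNormedModule)) in hl; auto.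
apply filterlim_ext_loc with (fun ab => RInt f (g (fst ab)) (g (snd ab))).
- generalize (ii_eventually HJ). apply filter_imp. intros ab [h1 [h2 h3]].
  symmetry. apply RInt_subst; auto.
- intros P hP. destruct (hl P hP) as [Q1 Q2 hQ1 hQ2 hQ].
  exists (fun y => Q1 (g y)) (fun y => Q2 (g y)); [apply ha, hQ1 | apply hb, hQ2 |].
  intros x y h1 h2. exact (hQ _ _ h1 h2).
Qed.

(** Here [g] exchanges the two ends, so swapping the bounds of each proper integral accounts for the
    sign. This is the form needed for [s = t exp (- u)]. *)
Lemma is_RInt_gen_subst_decreasing :
  filterlim g Ga Fb -> filterlim g Gb Fa ->
  is_RInt_gen (fun y => - dg y * f (g y)) Ga Gb l.
Proof.
intros ha hb.
assert (e : is_RInt_gen (fun y => dg y * f (g y)) Ga Gb (opp l)).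
{ apply (is_RInt_gen_filterlim HJ (V := R_CompleteNormedModule)); auto.
  apply (is_RInt_gen_filterlim HI (V := R_CompleteNormedModule)) in hl; auto.
  apply filterlim_ext_loc with (fun ab => opp (RInt f (g (snd ab)) (g (fst ab)))).
  - generalize (ii_eventually HJ). apply filter_imp. intros ab [h1 [h2 h3]].
    rewrite RInt_subst; auto. apply (opp_RInt_swap (V := R_CompleteNormedModule)).
    apply (ii_ex_RInt HI (V := R_CompleteNormedModule)); auto.
  - apply filterlim_comp with (G := locally l).
    + intros P hP. destruct (hl P hP) as [Q1 Q2 hQ1 hQ2 hQ].
      exists (fun y => Q2 (g y)) (fun y => Q1 (g y)); [apply ha, hQ2 | apply hb, hQ1 |].
      intros x y h1 h2. exact (hQ _ _ h2 h1).
    + apply (filterlim_opp (V := R_NormedModule) l). }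
apply (is_RInt_gen_opp (V := R_NormedModule)) in e; try apply _.
rewrite opp_opp in e.
apply (is_RInt_gen_ext_on HJ (V := R_CompleteNormedModule)) with (2 := e).
intros x _. unfold opp; cbn. ring.
Qed.

End Substitution.

(** Comparison with a derivative bounds every proper integral by an increment of [F], so it is
    enough that [F] has bounded oscillation; the majorant need not be integrated up to the ends. *)
Lemma is_RInt_gen_bounded_by_derive {I Fa Fb} (HI : improper_interval I Fa Fb)
    (f F dF : R -> R) M :
  (forall x, I x -> continuous f x) ->
  (forall x, I x -> is_derive F x (dF x)) -> (forall x, I x -> continuous dF x) ->
  (forall x, I x -> 0 <= f x <= dF x) ->
  (forall x y, I x -> I y -> F y - F x <= M) ->
  exists l, is_RInt_gen f Fa Fb l.
Proof.
intros cf hF cF hf hM.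
destruct (is_RInt_gen_nonneg_bounded HI f cf) with (M := M) as [l [hl _]].
- intros x hx. apply hf, hx.
- intros a b ha hb hab. apply Rle_trans with (F b - F a); auto.
  assert (hi : forall x, Rmin a b <= x <= Rmax a b -> I x).
  { intros x hx. rewrite Rmin_left, Rmax_right in hx by auto.
    apply (ii_convex HI) with a b; auto. }
  assert (e : is_RInt dF a b (minus (F b) (F a))).
  { apply (is_RInt_derive (V := R_CompleteNormedModule) F dF); auto. }
  change (RInt f a b <= minus (F b) (F a)).
  rewrite <- (is_RInt_unique (V := R_CompleteNormedModule) _ _ _ _ e).
  apply RInt_le; auto.
  + apply (ii_ex_RInt HI (V := R_CompleteNormedModule)); auto.
  + eexists; exact e.
  + intros x hx. apply hf, (ii_convex HI) with a b; auto; lra.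
- exists l; auto.
Qed.

(** * Elementary bounds and limits for the exponential, the logarithm and real powers *)

Lemma Rpower_pos x y : 0 < Rpower x y.
Proof. apply exp_pos. Qed.

Lemma one_plus_le_exp x : 1 + x <= exp x.
Proof.
destruct (Req_dec x 0) as [-> | h]; [rewrite exp_0; lra |].
left. now apply exp_ineq1.
Qed.

Lemma exp_le_compat x y : x <= y -> exp x <= exp y.
Proof. intros [h | ->]; [left; now apply exp_increasing | lra]. Qed.

Lemma ln_le_minus_1 x : 0 < x -> ln x <= x - 1.
Proof.
intros hx. assert (h := one_plus_le_exp (ln x)). rewrite exp_ln in h; lra.
Qed.

(** Weighted arithmetic-geometric mean of [z] and 1. The inequality [1 + x <= exp x] is taken at
    [(1 - y) ln z] and at [- y ln z]; with weights [y] and [1 - y] the linear terms cancel, and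
    multiplication by [z^y] finishes. *)
Lemma Rpower_young z y : 0 < z -> 0 <= y <= 1 -> Rpower z y <= y * z + (1 - y).
Proof.
intros hz hy. unfold Rpower.
assert (h1 := one_plus_le_exp ((1 - y) * ln z)).
assert (h2 := one_plus_le_exp (- y * ln z)).
assert (e1 : z = exp (y * ln z) * exp ((1 - y) * ln z)).
{ rewrite <- exp_plus. replace (_ + _) with (ln z) by ring. now rewrite exp_ln. }
assert (e2 : 1 = exp (y * ln z) * exp (- y * ln z)).
{ rewrite <- exp_plus. replace (_ + _) with 0 by ring. now rewrite exp_0. }
set (w := exp (y * ln z)) in *.
assert (hw : 0 < w) by apply exp_pos.
assert (h3 : 1 <= y * exp ((1 - y) * ln z) + (1 - y) * exp (- y * ln z)) by nra.
apply (Rmult_le_compat_l _ _ _ (Rlt_le _ _ hw)) in h3.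
rewrite Rmult_1_r in h3. apply Rle_trans with (1 := h3). right.
transitivity (y * (w * exp ((1 - y) * ln z)) + (1 - y) * (w * exp (- y * ln z))).
- ring.
- rewrite <- e2, <- e1. ring.
Qed.

Lemma Rpower_exp_bound a : 0 < a ->
  exists C, forall t, 0 <= t -> Rpower (1 + t) a * exp (- t) <= C.
Proof.
intros ha. exists (exp (1 - a + a * ln a)). intros t ht.
unfold Rpower. rewrite <- exp_plus.
assert (h := ln_le_minus_1 ((1 + t) / a) ltac:(apply Rdiv_lt_0_compat; lra)).
rewrite ln_div in h by lra.
assert (a * (ln (1 + t) - ln a) <= a * ((1 + t) / a - 1)) by (apply Rmult_le_compat_l; lra).
replace (a * ((1 + t) / a - 1)) with (1 + t - a) in H by (field; lra).
apply exp_le_compat. lra.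
Qed.

Lemma filterlim_Rpower_0 x : 0 < x -> filterlim (fun t => Rpower t x) (at_right 0) (locally 0).
Proof.
intros hx. apply filterlim_locally. intros e.
exists (mkposreal (Rpower e (/ x)) (Rpower_pos _ _)). intros y hy hy0.
apply Rabs_def2 in hy. cbn in hy. unfold minus, plus, opp in hy. cbn in hy.
apply Rabs_def1; unfold minus, plus, opp; cbn.
- assert (h : Rpower y x < Rpower (Rpower e (/ x)) x).
  { apply Rlt_Rpower_l; lra. }
  rewrite Rpower_mult, Rinv_l, Rpower_1 in h; try lra. apply cond_pos.
- assert (h := Rpower_pos y x). assert (h2 := cond_pos e). lra.
Qed.

Lemma is_derive_Rpower x y : 0 < x -> is_derive (fun t => Rpower t y) x (y * Rpower x (y - 1)).
Proof.
intros hx. unfold Rpower. auto_derive; auto.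
replace ((y - 1) * ln x) with (y * ln x + - ln x) by ring.
rewrite exp_plus, exp_Ropp, exp_ln by auto. field. lra.
Qed.

Lemma continuous_Rpower x y : 0 < x -> continuous (fun t => Rpower t y) x.
Proof.
intros hx. apply (ex_derive_continuous (V := R_NormedModule)).
eexists; apply is_derive_Rpower, hx.
Qed.

Lemma continuous_at_right (f : R -> R) x :
  continuous f x -> filterlim f (at_right x) (locally (f x)).
Proof.
intros h P hP. unfold filtermap. apply (filter_le_within (F := locally x)), h, hP.
Qed.

(** * Convergence, recurrence and growth of Euler's integral *)

Definition Gamma_integrand (x t : R) : R := Rpower t (x - 1) * exp (- t).

Lemma Gamma_integrand_pos x t : 0 < Gamma_integrand x t.
Proof. apply Rmult_lt_0_compat; apply exp_pos. Qed.

Lemma continuous_Gamma_integrand x t : 0 < t -> continuous (Gamma_integrand x) t.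
Proof.
intros ht. apply (ex_derive_continuous (V := R_NormedModule)).
unfold Gamma_integrand, Rpower. auto_derive. auto.
Qed.

Lemma Gamma_correct x : 0 < x ->
  is_RInt_gen (Gamma_integrand x) (at_right 0) (Rbar_locally p_infty) (Gamma x).
Proof.
intros hx. apply (RInt_gen_correct (V := R_CompleteNormedModule)).
(* Replacing [exp (- t)] by [C (1 + t)^(- x - 1)] gives a majorant with an explicit antiderivative,
   which treats both ends at once. *)
destruct (Rpower_exp_bound (x + 1)) as [C hC]; [lra |].
assert (hC0 : 0 < C).
{ specialize (hC 0 (Rle_refl 0)). assert (0 < Rpower (1 + 0) (x + 1) * exp (- 0)).
  { apply Rmult_lt_0_compat; apply exp_pos. } lra. }
(* [(t / (1 + t))^x] is bounded, and its derivative is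
   [x * t^(x - 1) * (1 + t)^(- x - 1)] *)
apply (is_RInt_gen_bounded_by_derive improper_interval_pos (Gamma_integrand x)
  (fun t => C / x * Rpower (t / (1 + t)) x)
  (fun t => C * (Rpower (t / (1 + t)) (x - 1) * / (1 + t) ^ 2)) (C / x)).
- intros; now apply continuous_Gamma_integrand.
- intros t ht.
  assert (ht' : 0 < t / (1 + t)) by (apply Rdiv_lt_0_compat; lra).
  evar_last.
  + apply is_derive_scal. apply (is_derive_comp (fun t => Rpower t x) (fun t => t / (1 + t))).
    * apply is_derive_Rpower, ht'.
    * auto_derive; [lra | reflexivity].
  + unfold scal; cbn; unfold mult; cbn. field. lra.
- intros t ht.
  assert (ht' : 0 < t / (1 + t)) by (apply Rdiv_lt_0_compat; lra).
  apply (ex_derive_continuous (V := R_NormedModule)). unfold Rpower. auto_derive.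
  repeat split; auto; try lra. nra.
- intros t ht.
  assert (ht' : 0 < t / (1 + t)) by (apply Rdiv_lt_0_compat; lra).
  split; [left; apply Gamma_integrand_pos |].
  unfold Gamma_integrand.
  replace (C * (Rpower (t / (1 + t)) (x - 1) * / (1 + t) ^ 2)) with
    (Rpower t (x - 1) * (C * / Rpower (1 + t) (x + 1))).
  + apply Rmult_le_compat_l; [left; apply exp_pos |].
    specialize (hC t (Rlt_le _ _ ht)). assert (hp := Rpower_pos (1 + t) (x + 1)).
    apply Rmult_le_reg_l with (1 := hp).
    replace (Rpower (1 + t) (x + 1) * (C * / Rpower (1 + t) (x + 1))) with C by (field; lra).
    exact hC.
  + assert (e : Rpower t (x - 1) = Rpower (t / (1 + t)) (x - 1) * Rpower (1 + t) (x - 1)).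
    { rewrite Rpower_mult_distr by lra. f_equal. field. lra. }
    rewrite e. replace (x + 1) with ((x - 1) + INR 2) by (cbn; ring).
    rewrite Rpower_plus, Rpower_pow by lra.
    assert (hp := Rpower_pos (1 + t) (x - 1)). field. lra.
- intros t s ht hs.
  assert (hb : Rpower (s / (1 + s)) x <= 1).
  { apply Rle_trans with (Rpower 1 x).
    - apply Rle_Rpower_l; [lra |]. split; [apply Rdiv_lt_0_compat; lra |].
      apply Rmult_le_reg_r with (1 + s); [lra |]. field_simplify; lra.
    - unfold Rpower. rewrite ln_1, Rmult_0_r, exp_0. lra. }
  assert (0 < C / x) by (apply Rdiv_lt_0_compat; lra).
  assert (hp := Rpower_pos (t / (1 + t)) x). nra.
Qed.

(** Integration by parts in one piece: the difference of the two integrands is the derivative of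
    [- t^x exp (- t)], which vanishes at both ends. *)
Lemma Gamma_S x : 0 < x -> Gamma (x + 1) = x * Gamma x.
Proof.
intros hx.
assert (h1 := Gamma_correct (x + 1) ltac:(lra)).
assert (h2 := Gamma_correct x hx).
assert (h3 : is_RInt_gen (fun t => Gamma_integrand (x + 1) t - x * Gamma_integrand x t)
  (at_right 0) (Rbar_locally p_infty) (0 - 0)).
{ apply (is_RInt_gen_derive improper_interval_pos (fun t => - (Rpower t x * exp (- t)))).
  - intros t ht. unfold Gamma_integrand.
    evar_last.
    + apply (is_derive_opp (V := R_NormedModule)). apply (is_derive_mult (fun t => Rpower t x) (fun t => exp (- t))).
      * apply is_derive_Rpower, ht.
      * auto_derive; [auto | reflexivity].
      * intros; apply Rmult_comm.
    + unfold plus, mult, opp; cbn. replace (x + 1 - 1) with x by ring. ring.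
  - intros t ht. apply (continuous_minus (V := R_NormedModule)).
    + now apply continuous_Gamma_integrand.
    + apply (continuous_scal_r (V := R_NormedModule) x (Gamma_integrand x)).
      now apply continuous_Gamma_integrand.
  - replace 0 with (- (0 * exp (- 0))) at 2 by ring.
    apply (filterlim_comp _ _ _ (fun t => Rpower t x * exp (- t)) Ropp _ (locally (0 * exp (-0)))).
    + apply (filterlim_comp_2 (F := at_right 0) (G := locally 0) (H := locally (exp (- 0))) (fun t => Rpower t x) (fun t => exp (- t))).
      * apply filterlim_Rpower_0, hx.
      * apply (continuous_at_right (fun t => exp (- t)) 0).
        apply (ex_derive_continuous (V := R_NormedModule)). auto_derive. auto.
      * apply (filterlim_mult (K := R_AbsRing)).
    + apply (filterlim_opp (V := R_NormedModule)).
  - destruct (Rpower_exp_bound (x + 1)) as [C hC]; [lra |].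
    assert (hC0 : 0 < C).
    { specialize (hC 0 (Rle_refl 0)). assert (0 < Rpower (1 + 0) (x + 1) * exp (- 0)).
      { apply Rmult_lt_0_compat; apply exp_pos. } lra. }
    apply filterlim_locally. intros e. exists (C / e). intros t ht.
    assert (he := cond_pos e).
    assert (ht0 : 0 < t).
    { apply Rlt_trans with (2 := ht). apply Rdiv_lt_0_compat; lra. }
    specialize (hC t (Rlt_le _ _ ht0)).
    assert (h4 : 0 < Rpower t x * exp (- t)) by (apply Rmult_lt_0_compat; apply exp_pos).
    assert (h5 : Rpower t x * exp (- t) <= Rpower (1 + t) x * exp (- t)).
    { apply Rmult_le_compat_r; [left; apply exp_pos |]. apply Rle_Rpower_l; lra. }
    rewrite Rpower_plus, Rpower_1 in hC by lra.
    assert (h6 : C < e * t).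
    { apply Rmult_lt_reg_r with (/ e); [now apply Rinv_0_lt_compat |].
      replace (e * t * / e) with t by (field; lra). exact ht. }
    assert (h7 : Rpower (1 + t) x * exp (- t) < e).
    { apply Rmult_lt_reg_r with (1 + t); nra. }
    apply Rabs_def1; unfold minus, plus, opp; cbn; lra. }
assert (h4 := is_RInt_gen_minus (V := R_NormedModule) _ _ _ _ h1
  (is_RInt_gen_scal (V := R_NormedModule) _ x _ h2)).
assert (e := is_RInt_gen_inj improper_interval_pos (V := R_CompleteNormedModule) _ _ _ h3 h4).
change (0 - 0 = Gamma (x + 1) - x * Gamma x) in e. lra.
Qed.

(** Only the part of the integral over [[r, r + 1]] is kept. Since [r] is free, this shows that
    Gamma outgrows every geometric sequence, which is all that convergence of the Mittag-Leffler
    series requires. *)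
Lemma Gamma_S_ge x r : 0 <= x -> 0 < r -> Rpower r x * exp (- (r + 1)) <= Gamma (x + 1).
Proof.
intros hx hr.
assert (h := Gamma_correct (x + 1) ltac:(lra)).
apply Rle_trans with (RInt (Gamma_integrand (x + 1)) r (r + 1)).
- replace (Rpower r x * exp (- (r + 1))) with
    (RInt (fun _ => Rpower r x * exp (- (r + 1))) r (r + 1)).
  + apply RInt_le; [lra | apply ex_RInt_const | |].
    * apply (ii_ex_RInt improper_interval_pos (V := R_CompleteNormedModule)); try lra.
      intros; now apply continuous_Gamma_integrand.
    * intros t ht. unfold Gamma_integrand. replace (x + 1 - 1) with x by ring.
      apply Rmult_le_compat; try (left; apply exp_pos).
      -- apply Rle_Rpower_l; lra.
      -- apply exp_le_compat. lra.
  + rewrite (RInt_const (V := R_CompleteNormedModule) r (r + 1)).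
    change ((r + 1 - r) * (Rpower r x * exp (- (r + 1))) = Rpower r x * exp (- (r + 1))).
    ring.
- apply (RInt_le_RInt_gen improper_interval_pos); auto; try lra.
  + intros; now apply continuous_Gamma_integrand.
  + intros; left; apply Gamma_integrand_pos.
Qed.

Lemma Gamma_pos x : 0 < x -> 0 < Gamma x.
Proof.
intros hx. assert (h := Gamma_S_ge x 1 ltac:(lra) Rlt_0_1).
assert (0 < Rpower 1 x * exp (- (1 + 1))) by (apply Rmult_lt_0_compat; apply exp_pos).
rewrite Gamma_S in h by auto.
apply Rmult_lt_reg_l with x; lra.
Qed.

Lemma Gamma_1 : Gamma 1 = 1.
Proof.
assert (h1 := Gamma_correct 1 Rlt_0_1).
assert (h2 : is_RInt_gen (fun t => exp (- t)) (at_right 0) (Rbar_locally p_infty) (0 - - 1)).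
{ apply (is_RInt_gen_derive improper_interval_pos (fun t => - exp (- t))).
  - intros t _. auto_derive; auto. ring.
  - intros t _. apply (ex_derive_continuous (V := R_NormedModule)). auto_derive. auto.
  - replace (- 1) with (- exp (- 0)) by (rewrite Ropp_0, exp_0; ring).
    apply (continuous_at_right (fun t => - exp (- t)) 0).
    apply (ex_derive_continuous (V := R_NormedModule) (fun t => - exp (- t))). auto_derive. auto.
  - apply filterlim_locally. intros e. exists (/ e). intros t ht.
    assert (he := cond_pos e). assert (hie : 0 < / e) by now apply Rinv_0_lt_compat.
    assert (h := one_plus_le_exp t).
    assert (hp := exp_pos (- t)).
    assert (h3 : exp t * exp (- t) = 1).
    { rewrite <- exp_plus. replace (t + - t) with 0 by ring. apply exp_0. }
    assert (h4 : 1 < e * t).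
    { apply Rmult_lt_reg_r with (/ e); [auto |].
      replace (e * t * / e) with t by (field; lra). lra. }
    assert (h7 : exp (- t) < e) by nra.
    apply Rabs_def1; unfold minus, plus, opp; cbn; lra. }
apply (is_RInt_gen_ext_on improper_interval_pos (V := R_CompleteNormedModule)) with
  (g := Gamma_integrand 1) in h2.
- assert (e := is_RInt_gen_inj improper_interval_pos (V := R_CompleteNormedModule) _ _ _ h1 h2).
  rewrite e. ring.
- intros t ht. change (exp (- t) = Gamma_integrand 1 t).
  unfold Gamma_integrand. rewrite Rminus_diag, Rpower_O by auto. ring.
Qed.

(** Log-convexity without Hölder: [Rpower_young] at [t / x] bounds [t^y] by [x^y (y t / x + 1 - y)],
    and integration against the Gamma density of parameter [x] makes the bracket contribute exactly
    [Gamma x]. *)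
Lemma Gamma_plus_le x y : 0 < x -> 0 <= y <= 1 -> Gamma (x + y) <= Gamma x * Rpower x y.
Proof.
intros hx hy.
assert (hS := Gamma_correct (x + 1) ltac:(lra)).
assert (h := is_RInt_gen_plus (V := R_NormedModule) _ _ _ _
   (is_RInt_gen_scal (V := R_NormedModule) _ (y / x) _ hS)
   (is_RInt_gen_scal (V := R_NormedModule) _ (1 - y) _ (Gamma_correct x hx))).
apply (is_RInt_gen_scal (V := R_NormedModule) _ (Rpower x y)) in h; try apply _.
replace (Gamma x * Rpower x y) with
  (scal (Rpower x y) (plus (scal (y / x) (Gamma (x + 1))) (scal (1 - y) (Gamma x)))).
- assert (hP := Gamma_correct (x + y) ltac:(lra)).
  apply (is_RInt_gen_le improper_interval_pos) with (2 := hP) (3 := h).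
  intros t ht. split; [left; apply Gamma_integrand_pos |].
  unfold plus, scal; cbn; unfold mult; cbn. unfold Gamma_integrand.
  assert (hyo := Rpower_young (t / x) y ltac:(apply Rdiv_lt_0_compat; lra) hy).
  assert (e : Rpower t y = Rpower x y * Rpower (t / x) y).
  { rewrite Rpower_mult_distr; try apply Rdiv_lt_0_compat; auto. f_equal. field. lra. }
  replace (x + y - 1) with ((x - 1) + y) by ring.
  replace (x + 1 - 1) with ((x - 1) + 1) by ring.
  rewrite !Rpower_plus, Rpower_1, e by auto.
  assert (hq : 0 < Rpower x y * (Rpower t (x - 1) * exp (- t))).
  { repeat apply Rmult_lt_0_compat; apply exp_pos. }
  apply (Rmult_le_compat_l _ _ _ (Rlt_le _ _ hq)) in hyo.
  eapply Rle_trans; [| eapply Rle_trans; [exact hyo |]]; right; field; lra.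
- rewrite Gamma_S by auto. unfold plus, scal; cbn; unfold mult; cbn. field. lra.
Qed.

(** The upper bound is applied from [x + y] with increment [1 - y], which lands on [x + 1]; the
    recurrence then turns it into a lower bound. *)
Lemma Gamma_plus_ge x y : 0 < x -> 0 <= y <= 1 ->
  x / (x + y) * (Gamma x * Rpower x y) <= Gamma (x + y).
Proof.
intros hx hy.
assert (h := Gamma_plus_le (x + y) (1 - y) ltac:(lra) ltac:(lra)).
replace (x + y + (1 - y)) with (x + 1) in h by ring.
rewrite Gamma_S in h by auto. unfold Rminus in h.
rewrite Rpower_plus, Rpower_1, Rpower_Ropp in h by lra.
assert (hp := Rpower_pos (x + y) y).
assert (hx' := Rpower_pos x y).
assert (hG := Gamma_pos (x + y) ltac:(lra)).
assert (hG' := Gamma_pos x ltac:(lra)).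
assert (hm : Rpower x y <= Rpower (x + y) y) by (apply Rle_Rpower_l; lra).
apply Rmult_le_reg_l with ((x + y) * / Rpower (x + y) y).
{ apply Rmult_lt_0_compat; [lra |]. now apply Rinv_0_lt_compat. }
apply Rle_trans with (x * Gamma x); [| lra].
apply Rle_trans with (x * Gamma x * (Rpower x y / Rpower (x + y) y)).
- right. field. lra.
- rewrite <- (Rmult_1_r (x * Gamma x)) at 2. apply Rmult_le_compat_l; [nra |].
  apply Rmult_le_reg_r with (Rpower (x + y) y); auto. field_simplify; lra.
Qed.

(** * The beta integral *)

Lemma Rpower_le_base_neg a b p : 0 < a <= b -> p <= 0 -> Rpower b p <= Rpower a p.
Proof.
intros hab hp. replace p with (- - p) by ring. rewrite 2!(Rpower_Ropp _ (- p)).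
apply Rinv_le_contravar; [apply Rpower_pos |]. apply Rle_Rpower_l; lra.
Qed.

(** The Laplace transform of [u^(y - 1)], by the substitution [t = x u]; it is the model to which
    the beta integral is compared. *)
Lemma Gamma_scaled x y : 0 < x -> 0 < y ->
  is_RInt_gen (fun u => exp (- (x * u)) * Rpower u (y - 1))
    (at_right 0) (Rbar_locally p_infty) (Gamma y * Rpower x (- y)).
Proof.
intros hx hy.
assert (h : is_RInt_gen (fun u => x * Gamma_integrand y (x * u))
  (at_right 0) (Rbar_locally p_infty) (Gamma y)).
{ apply (is_RInt_gen_subst_increasing improper_interval_pos improper_interval_pos
    (Gamma_integrand y) (fun u => x * u) (fun _ => x)).
  - intros; now apply continuous_Gamma_integrand.
  - intros; nra.
  - intros. auto_derive; auto. ring.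
  - intros. apply continuous_const.
  - apply Gamma_correct, hy.
  - intros P [e he]. assert (hd : 0 < e / x) by (apply Rdiv_lt_0_compat; [apply cond_pos | auto]).
    exists (mkposreal _ hd). intros u hu hu0. apply he; [| nra].
    apply Rabs_def2 in hu. cbn in hu. unfold minus, plus, opp in hu. cbn in hu.
    assert (x * u < e).
    { replace (pos e) with (x * (e / x)) by (field; lra). apply Rmult_lt_compat_l; lra. }
    assert (hp := cond_pos e). assert (0 < x * u) by nra.
    apply Rabs_def1; unfold minus, plus, opp; cbn; lra.
  - intros P [M hM]. exists (M / x). intros u hu. apply hM.
    replace M with (x * (M / x)) by (field; lra). apply Rmult_lt_compat_l; lra. }
apply (is_RInt_gen_scal (V := R_NormedModule) _ (Rpower x (- y))) in h; try apply _.
rewrite Rmult_comm.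
apply (is_RInt_gen_ext_on improper_interval_pos (V := R_CompleteNormedModule)) with (2 := h).
intros u hu. unfold scal; cbn; unfold mult; cbn. unfold Gamma_integrand.
rewrite <- Rpower_mult_distr by auto.
change (y - 1) with (y + Ropp 1).
rewrite (Rpower_plus y (Ropp 1) x), !Rpower_Ropp, Rpower_1 by auto.
assert (hp := Rpower_pos x y). field. lra.
Qed.

Definition beta_integrand (x y u : R) : R := exp (- (x * u)) * Rpower (1 - exp (- u)) (y - 1).

(* Euler's beta integral [int_0^1 s^(x-1) (1-s)^(y-1) ds] after [s = exp (- u)]. *)
Definition beta (x y : R) : R :=
  RInt_gen (beta_integrand x y) (at_right 0) (Rbar_locally p_infty).

Lemma exp_neg_lt_1 u : 0 < u -> 0 < 1 - exp (- u).
Proof. intros hu. assert (h := exp_increasing (- u) 0 ltac:(lra)). rewrite exp_0 in h. lra. Qed.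

Lemma continuous_beta_integrand x y u : 0 < u -> continuous (beta_integrand x y) u.
Proof.
intros hu. apply (ex_derive_continuous (V := R_NormedModule)).
unfold beta_integrand, Rpower. auto_derive. now apply exp_neg_lt_1.
Qed.

Lemma beta_integrand_pos x y u : 0 < beta_integrand x y u.
Proof. apply Rmult_lt_0_compat; apply exp_pos. Qed.

Section Beta.

Variables (y : R).
Hypothesis hy : 0 < y < 1.

(** From [u / (1 + u) <= 1 - exp (- u) <= u] and the negative exponent [y - 1], the second factor
    lies between [u^(y - 1)] and [u^(y - 1) (1 + u)]. Both sides are Laplace integrands, hence
    [beta x y] is [Gamma y * x^(- y)] up to a factor [1 + y / x]. The exponent [y + 1 - 1] is left
    unsimplified to match [Gamma_scaled]. *)
Let beta_integrand_bounds x u : 0 < u ->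
  exp (- (x * u)) * Rpower u (y - 1) <= beta_integrand x y u <=
  exp (- (x * u)) * Rpower u (y - 1) + exp (- (x * u)) * Rpower u (y + 1 - 1).
Proof.
intros hu. unfold beta_integrand. rewrite <- Rmult_plus_distr_l.
assert (h1 := one_plus_le_exp (- u)). assert (h2 := one_plus_le_exp u).
assert (h3 := exp_neg_lt_1 u hu).
split; apply Rmult_le_compat_l; try (left; apply exp_pos).
- apply Rpower_le_base_neg; lra.
- assert (h4 : u / (1 + u) <= 1 - exp (- u)).
  { apply Rmult_le_reg_r with (1 + u); [lra |].
    replace (u / (1 + u) * (1 + u)) with u by (field; lra).
    assert (h5 : exp u * exp (- u) = 1).
    { rewrite <- exp_plus. replace (u + - u) with 0 by ring. apply exp_0. }
    assert (hp := exp_pos (- u)). nra. }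
  apply Rle_trans with (Rpower (u / (1 + u)) (y - 1)).
  { apply Rpower_le_base_neg; [split; auto |]; [apply Rdiv_lt_0_compat |]; lra. }
  unfold Rdiv. rewrite <- Rpower_mult_distr by (auto; apply Rinv_0_lt_compat; lra).
  replace (y + 1 - 1) with ((y - 1) + 1) by ring. rewrite Rpower_plus, Rpower_1 by auto.
  rewrite <- (Rmult_1_r (Rpower u (y - 1))) at 2. rewrite <- Rmult_plus_distr_l.
  apply Rmult_le_compat_l; [left; apply exp_pos |].
  rewrite <- (Rpower_1 (1 + u)) at 2 by lra.
  replace (Rpower (/ (1 + u)) (y - 1)) with (Rpower (1 + u) (1 - y)).
  + apply Rle_Rpower; lra.
  + unfold Rpower. rewrite ln_Rinv by lra. f_equal. ring.
Qed.

Let upper x : 0 < x -> is_RInt_gen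
  (fun u => exp (- (x * u)) * Rpower u (y - 1) + exp (- (x * u)) * Rpower u (y + 1 - 1))
  (at_right 0) (Rbar_locally p_infty)
  (Gamma y * Rpower x (- y) + Gamma (y + 1) * Rpower x (- (y + 1))).
Proof.
intros hx.
assert (h1 := Gamma_scaled x y hx (proj1 hy)).
assert (h2 := Gamma_scaled x (y + 1) hx ltac:(lra)).
exact (is_RInt_gen_plus (V := R_NormedModule) _ _ _ _ h1 h2).
Qed.

Let continuous_scaled x z u : 0 < u -> continuous (fun u => exp (- (x * u)) * Rpower u z) u.
Proof.
intros hu. apply (ex_derive_continuous (V := R_NormedModule)). unfold Rpower. auto_derive. auto.
Qed.

Lemma beta_correct x : 0 < x ->
  is_RInt_gen (beta_integrand x y) (at_right 0) (Rbar_locally p_infty) (beta x y).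
Proof.
intros hx. apply (RInt_gen_correct (V := R_CompleteNormedModule)).
edestruct (is_RInt_gen_dominated improper_interval_pos (beta_integrand x y))
  with (4 := upper x hx) as [l [hl _]].
- intros u hu. now apply continuous_beta_integrand.
- intros u hu. apply (continuous_plus (V := R_NormedModule)); now apply continuous_scaled.
- intros u hu. split; [left; apply beta_integrand_pos | now apply beta_integrand_bounds].
- exists l. exact hl.
Qed.

Lemma beta_ge x : 0 < x -> Gamma y * Rpower x (- y) <= beta x y.
Proof.
intros hx.
apply (is_RInt_gen_le improper_interval_pos) with
  (2 := Gamma_scaled x y hx (proj1 hy)) (3 := beta_correct x hx).
intros u hu. split; [| now apply beta_integrand_bounds].
left. apply Rmult_lt_0_compat; apply exp_pos.
Qed.

Lemma beta_le x : 0 < x -> beta x y <= Gamma y * Rpower x (- y) * (1 + y / x).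
Proof.
intros hx.
replace (Gamma y * Rpower x (- y) * (1 + y / x)) with
  (Gamma y * Rpower x (- y) + Gamma (y + 1) * Rpower x (- (y + 1))).
- apply (is_RInt_gen_le improper_interval_pos) with
    (2 := beta_correct x hx) (3 := upper x hx).
  intros u hu. split; [left; apply beta_integrand_pos | now apply beta_integrand_bounds].
- rewrite Gamma_S by lra. rewrite !Rpower_Ropp, Rpower_plus, Rpower_1 by lra.
  assert (hp := Rpower_pos x y). field. lra.
Qed.

(** The combination of integrands is the derivative of [exp (- x u) (1 - exp (- u))^y], whose limits
    at both ends are 0. *)
Lemma beta_S x : 0 < x -> (x + y) * beta (x + 1) y = x * beta x y.
Proof.
intros hx.
assert (h1 := beta_correct (x + 1) ltac:(lra)). assert (h2 := beta_correct x hx).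
apply (is_RInt_gen_scal (V := R_NormedModule) _ (x + y)) in h1; try apply _.
apply (is_RInt_gen_scal (V := R_NormedModule) _ x) in h2; try apply _.
assert (h3 := is_RInt_gen_minus (V := R_NormedModule) _ _ _ _ h1 h2).
assert (h4 : is_RInt_gen
  (fun u => minus (scal (x + y) (beta_integrand (x + 1) y u)) (scal x (beta_integrand x y u)))
  (at_right 0) (Rbar_locally p_infty) (0 - 0)).
{ apply (is_RInt_gen_derive improper_interval_pos
    (fun u => exp (- (x * u)) * Rpower (1 - exp (- u)) y)).
  - intros u hu. assert (h0 := exp_neg_lt_1 u hu). unfold Rpower. auto_derive; [lra |].
    unfold minus, plus, opp, scal; cbn; unfold mult; cbn. unfold beta_integrand.
    fold (Rpower (1 + - exp (- u)) y). replace (1 - exp (- u)) with (1 + - exp (- u)) in * by ring.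
    replace (Rpower (1 + - exp (- u)) y) with
      (Rpower (1 + - exp (- u)) (y - 1) * (1 + - exp (- u))).
    + replace (- ((x + 1) * u)) with (- (x * u) + - u) by ring. rewrite exp_plus.
      field. lra.
    + rewrite <- (Rpower_1 (1 + - exp (- u))) at 2 by auto. rewrite <- Rpower_plus.
      f_equal. ring.
  - intros u hu. apply (continuous_minus (V := R_NormedModule));
    apply (continuous_scal_r (V := R_NormedModule)); now apply continuous_beta_integrand.
  - replace 0 with (exp (- (x * 0)) * 0) at 2 by ring.
    apply (filterlim_comp_2 (F := at_right 0) (G := locally (exp (- (x * 0)))) (H := locally 0)
      (fun u => exp (- (x * u))) (fun u => Rpower (1 - exp (- u)) y)).
    + apply (continuous_at_right (fun u => exp (- (x * u))) 0).
      apply (ex_derive_continuous (V := R_NormedModule)). auto_derive. auto.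
    + refine (filterlim_le_le (F := at_right 0) (fun _ => 0) _ (fun u => Rpower u y) 0 _ _ _).
      * generalize (ii_left improper_interval_pos). apply filter_imp. intros u hu.
        assert (h0 := exp_neg_lt_1 u hu). assert (h5 := one_plus_le_exp (- u)).
        split; [left; apply exp_pos |]. apply Rle_Rpower_l; lra.
      * apply filterlim_const.
      * apply (filterlim_Rpower_0 y (proj1 hy)).
    + apply (filterlim_mult (K := R_AbsRing)).
  - apply filterlim_locally. intros e.
    exists (Rmax 0 (/ (e * x))). intros u hu.
    assert (he := cond_pos e).
    assert (hu0 := Rle_lt_trans _ _ _ (Rmax_l _ _) hu).
    assert (hu1 := Rle_lt_trans _ _ _ (Rmax_r _ _) hu).
    assert (h0 := exp_neg_lt_1 u hu0).
    assert (h5 := one_plus_le_exp (x * u)). assert (h6 := exp_pos (- (x * u))).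
    assert (h7 : exp (x * u) * exp (- (x * u)) = 1).
    { rewrite <- exp_plus. replace (x * u + - (x * u)) with 0 by ring. apply exp_0. }
    assert (h8 : 1 < e * x * u).
    { apply Rmult_lt_reg_l with (/ (e * x)); [apply Rinv_0_lt_compat; nra |].
      replace (/ (e * x) * (e * x * u)) with u by (field; lra). lra. }
    assert (h9 : exp (- (x * u)) < e).
    { assert (0 < x * u) by nra.
      apply Rmult_lt_reg_r with (1 + x * u); [lra |].
      apply Rle_lt_trans with 1; [| lra].
      rewrite <- h7, Rmult_comm. apply Rmult_le_compat_r; lra. }
    assert (h10 : 0 < Rpower (1 - exp (- u)) y <= 1).
    { split; [apply exp_pos |]. apply Rle_trans with (Rpower 1 y).
      - apply Rle_Rpower_l; [lra |]. assert (h11 := exp_pos (- u)). lra.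
      - unfold Rpower. rewrite ln_1, Rmult_0_r, exp_0. lra. }
    apply Rabs_def1; unfold minus, plus, opp; cbn; nra. }
assert (e := is_RInt_gen_inj improper_interval_pos (V := R_CompleteNormedModule) _ _ _ h3 h4).
change ((x + y) * beta (x + 1) y - x * beta x y = 0 - 0) in e. lra.
Qed.

(* [beta x y * Gamma (x + y) / Gamma x] is 1-periodic in [x] and tends to
   [Gamma y] at infinity. *)
Lemma beta_Gamma x : 0 < x -> beta x y * Gamma (x + y) = Gamma x * Gamma y.
Proof.
intros hx0.
assert (hG := Gamma_pos y (proj1 hy)).
(* The powers [x^(- y)] from the beta estimates and [x^y] from the Gamma estimates cancel, which
   leaves [Gamma y] times a factor between [x / (x + y)] and [1 + y / x]. *)
assert (hbound : forall x, 0 < x ->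
  Rabs (beta x y * Gamma (x + y) / Gamma x - Gamma y) <= y * Gamma y / x).
{ clear x hx0. intros x hx.
  assert (h1 := beta_ge x hx). assert (h2 := beta_le x hx).
  assert (h3 := Gamma_plus_le x y hx ltac:(lra)).
  assert (h4 := Gamma_plus_ge x y hx ltac:(lra)).
  assert (hx1 := Gamma_pos x hx). assert (hp := Rpower_pos x y).
  assert (hxy := Gamma_pos (x + y) ltac:(lra)).
  rewrite Rpower_Ropp in h1, h2.
  assert (h5 : beta x y * Gamma (x + y) / Gamma x <= Gamma y * (1 + y / x)).
  { apply Rle_trans with
      (Gamma y * / Rpower x y * (1 + y / x) * (Gamma x * Rpower x y) / Gamma x).
    - apply Rmult_le_compat_r; [left; now apply Rinv_0_lt_compat |].
      apply Rmult_le_compat; auto; [| lra]. apply Rle_trans with (2 := h1).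
      apply Rmult_le_pos; [lra | left; now apply Rinv_0_lt_compat].
    - right. field. lra. }
  assert (h6 : Gamma y * (x / (x + y)) <= beta x y * Gamma (x + y) / Gamma x).
  { apply Rle_trans with
      (Gamma y * / Rpower x y * (x / (x + y) * (Gamma x * Rpower x y)) / Gamma x).
    - right. field. lra.
    - apply Rmult_le_compat_r; [left; now apply Rinv_0_lt_compat |].
      apply Rmult_le_compat; auto.
      + apply Rmult_le_pos; [lra | left; now apply Rinv_0_lt_compat].
      + apply Rmult_le_pos; [| nra]. left. apply Rdiv_lt_0_compat; lra. }
  assert (h7 : x / (x + y) >= 1 - y / x).
  { replace (x / (x + y)) with (1 - y / (x + y)) by (field; lra).
    assert (y / (x + y) <= y / x); [| lra].
    apply Rmult_le_compat_l; [lra |]. apply Rinv_le_contravar; lra. }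
  apply Rabs_le. unfold Rdiv in *. nra. }
assert (hper : forall n, beta (x + INR n) y * Gamma (x + INR n + y) / Gamma (x + INR n)
  = beta x y * Gamma (x + y) / Gamma x).
{ induction n as [| n IH].
  - cbn. now rewrite Rplus_0_r.
  - rewrite <- IH, S_INR. assert (hn := pos_INR n).
    assert (h1 := beta_S (x + INR n) ltac:(lra)).
    replace (x + (INR n + 1)) with (x + INR n + 1) by ring.
    replace (x + INR n + 1 + y) with (x + INR n + y + 1) by ring.
    rewrite !Gamma_S by lra.
    assert (hx1 := Gamma_pos (x + INR n) ltac:(lra)).
    replace (beta (x + INR n + 1) y * ((x + INR n + y) * Gamma (x + INR n + y))) with
      ((x + INR n) * beta (x + INR n) y * Gamma (x + INR n + y)) by (rewrite <- h1; ring).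
    field. lra. }
set (q := beta x y * Gamma (x + y) / Gamma x) in *.
assert (hq : q = Gamma y).
{ apply Rminus_diag_uniq. apply Rabs_eq_0. apply Rle_antisym; [| apply Rabs_pos].
  apply le_epsilon. intros e he. rewrite Rplus_0_l.
  destruct (nfloor_ex (y * Gamma y / e)) as [n hn].
  { left. apply Rdiv_lt_0_compat; nra. }
  assert (h := hbound (x + INR (S n)) ltac:(assert (h := pos_INR (S n)); lra)).
  rewrite hper in h. apply Rle_trans with (1 := h).
  rewrite S_INR. destruct hn as [hn0 hn].
  assert (hn' := pos_INR n).
  apply Rmult_le_reg_r with (x + (INR n + 1)); [lra |].
  unfold Rdiv at 1. rewrite Rmult_assoc, Rinv_l by lra.
  apply Rle_trans with (e * (y * Gamma y / e)); [right; field; lra |].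
  apply Rmult_le_compat_l; lra. }
assert (hx1 := Gamma_pos x hx0). rewrite <- hq. unfold q. field. lra.
Qed.

(** The substitution [u = ln t - ln s] carries [(0, t)] to [(0, +oo)] and the kernel to
    [t^(x + y - 1)] times the beta integrand, so the singularities at both ends are handled
    together. *)
Lemma is_RInt_gen_beta_kernel x t : 0 < x -> 0 < t ->
  is_RInt_gen (fun s => Rpower (t - s) (y - 1) * Rpower s (x - 1)) (at_right 0) (at_left t)
    (Gamma x * Gamma y / Gamma (x + y) * Rpower t (x + y - 1)).
Proof.
intros hx ht.
assert (h : is_RInt_gen (fun s => - (- / s) * beta_integrand x y (ln t - ln s))
  (at_right 0) (at_left t) (beta x y)).
{ apply (is_RInt_gen_subst_decreasing improper_interval_pos
    (improper_interval_bounded 0 t ht)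
    (beta_integrand x y) (fun s => ln t - ln s) (fun s => - / s)).
  - intros; now apply continuous_beta_integrand.
  - intros s hs. assert (ln s < ln t) by (apply ln_increasing; lra). lra.
  - intros s hs. auto_derive; [lra |]. field. lra.
  - intros s hs. apply (ex_derive_continuous (V := R_NormedModule)). auto_derive. lra.
  - apply beta_correct, hx.
  - intros P [M hM]. exists (mkposreal (t * exp (- M)) ltac:(apply Rmult_lt_0_compat; [auto | apply exp_pos])).
    intros s hs hs0. apply hM.
    apply Rabs_def2 in hs. cbn in hs. unfold minus, plus, opp in hs. cbn in hs.
    assert (hl : ln s < ln (t * exp (- M))) by (apply ln_increasing; lra).
    rewrite ln_mult, ln_exp in hl; [lra | auto | apply exp_pos].
  - intros P hP.
    assert (hc : continuous (fun s => ln t - ln s) t).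
    { apply (ex_derive_continuous (V := R_NormedModule)). auto_derive. auto. }
    (* Membership in [at_right 0] is a neighbourhood statement guarded by [0 < z]; the guard is
       discharged below, where [s < t] is available. *)
    assert (hP' : locally (ln t - ln t) (fun z => 0 < z -> P z))
      by (rewrite Rminus_diag; exact hP).
    assert (h := filter_and _ _ (filter_le_within (F := locally t) (fun s => s < t) _
      (hc _ hP'))
      (ii_right (improper_interval_bounded 0 t ht))).
    change (within (fun s => s < t) (locally t) (fun s => P (ln t - ln s))).
    revert h. apply filter_imp. intros s [h1 h2]. apply h1.
    assert (ln s < ln t) by (apply ln_increasing; lra). lra. }
apply (is_RInt_gen_scal (V := R_NormedModule) _ (Rpower t (x + y - 1))) in h; try apply _.
replace (Gamma x * Gamma y / Gamma (x + y) * Rpower t (x + y - 1)) with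
  (scal (Rpower t (x + y - 1)) (beta x y)).
- apply (is_RInt_gen_ext_on (improper_interval_bounded 0 t ht)
    (V := R_CompleteNormedModule)) with (2 := h).
  intros s hs.
  change (Rpower t (x + y - 1) * (- - / s * beta_integrand x y (ln t - ln s)) =
    Rpower (t - s) (y - 1) * Rpower s (x - 1)).
  unfold beta_integrand.
  replace (- (x * (ln t - ln s))) with (x * ln s + - (x * ln t)) by ring.
  replace (- (ln t - ln s)) with (ln s + - ln t) by ring.
  rewrite !exp_plus, !exp_Ropp, !exp_ln by lra.
  fold (Rpower s x) (Rpower t x).
  replace (1 - s * / t) with ((t - s) * / t) by (field; lra).
  rewrite <- Rpower_mult_distr by (try apply Rinv_0_lt_compat; lra).
  replace (Rpower (/ t) (y - 1)) with (/ Rpower t (y - 1)).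
  2: { unfold Rpower. rewrite ln_Rinv, <- exp_Ropp by lra. f_equal. ring. }
  replace (x + y - 1) with (x + (y - 1)) by ring.
  rewrite Rpower_plus. replace (Rpower s x) with (Rpower s (x - 1) * s).
  2: { rewrite <- (Rpower_1 s) at 2 by lra. rewrite <- Rpower_plus. f_equal. ring. }
  assert (h1 := Rpower_pos t x). assert (h2 := Rpower_pos t (y - 1)). field. lra.
- change (Rpower t (x + y - 1) * beta x y =
    Gamma x * Gamma y / Gamma (x + y) * Rpower t (x + y - 1)).
  rewrite <- beta_Gamma by auto. assert (h1 := Gamma_pos (x + y) ltac:(lra)). field. lra.
Qed.

End Beta.

(** * Vector-valued power series *)

Lemma scal_0_l {V : NormedModule R_AbsRing} (x : V) : scal (0 : R) x = zero.
Proof. exact (scal_zero_l (K := R_AbsRing) x). Qed.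

Lemma scal_sub_sub {V : NormedModule R_AbsRing} (p q r s : R) (v : V) :
  minus (minus (scal p v) (scal q v)) (scal r (scal s v)) = scal (p - q - r * s) v.
Proof.
etransitivity; [| symmetry; apply (scal_minus_distr_r (K := R_AbsRing) (V := V) (p - q) (r * s) v)].
apply f_equal2.
- symmetry. apply (scal_minus_distr_r (K := R_AbsRing) (V := V) p q v).
- apply (scal_assoc (K := R_AbsRing) (V := V) r s v).
Qed.

(** * Bounded linear maps commute with series, integrals and derivatives *)

Section Linear.

Context {U V : NormedModule R_AbsRing}.
Variable L : U -> V.
Hypothesis hL : is_linear L.

Lemma linear_zero : L zero = zero.
Proof.
transitivity (L (scal 0 zero)); [f_equal; symmetry; apply scal_0_l |].
etransitivity; [apply (linear_scal L hL) |]. apply scal_0_l.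
Qed.

Lemma sum_n_linear (u : nat -> U) n : sum_n (fun k => L (u k)) n = L (sum_n u n).
Proof.
induction n as [| n IH].
- now rewrite !sum_O.
- now rewrite !sum_Sn, IH, linear_plus by exact hL.
Qed.

Lemma is_series_linear (u : nat -> U) l : is_series u l -> is_series (fun k => L (u k)) (L l).
Proof.
intros h. unfold is_series. apply filterlim_ext with (fun n => L (sum_n u n)).
- intros n. now rewrite sum_n_linear.
- apply filterlim_comp with (1 := h). now apply linear_cont.
Qed.

Lemma Riemann_sum_linear (f : R -> U) ptd :
  Riemann_sum (fun x => L (f x)) ptd = L (Riemann_sum f ptd).
Proof.
induction ptd as [x | h ptd IH] using SF_cons_ind.
- symmetry. apply linear_zero.
- rewrite !Riemann_sum_cons, IH. symmetry.
  etransitivity; [apply (linear_plus L hL) |]. f_equal. apply (linear_scal L hL).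
Qed.

Lemma is_RInt_linear (f : R -> U) a b l : is_RInt f a b l -> is_RInt (fun x => L (f x)) a b (L l).
Proof.
intros h. unfold is_RInt.
apply filterlim_ext with (fun ptd => L (scal (sign (b - a)) (Riemann_sum f ptd))).
- intros ptd. rewrite Riemann_sum_linear. apply (linear_scal L hL).
- apply filterlim_comp with (1 := h). now apply linear_cont.
Qed.

Lemma is_RInt_gen_linear Fa Fb {FFa : Filter Fa} {FFb : Filter Fb} (f : R -> U) l :
  is_RInt_gen f Fa Fb l -> is_RInt_gen (fun x => L (f x)) Fa Fb (L l).
Proof.
intros h P hP. specialize (h (fun y => P (L y)) (linear_cont L l hL P hP)).
unfold filtermapi in *. revert h. apply filter_imp.
intros ab [y [h1 h2]]. exists (L y). split; auto. now apply is_RInt_linear.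
Qed.

Lemma is_derive_linear (f : R -> U) x l : is_derive f x l -> is_derive (fun y => L (f y)) x (L l).
Proof.
intros h.
assert (e := filterdiff_comp' f L x _ L h (filterdiff_linear L hL)).
apply filterdiff_ext_lin with (1 := e). intros y. apply (linear_scal L hL).
Qed.

End Linear.

(** * Series in a normed space dominated by a real series *)

Section Normed_series.

Context {V : NormedModule R_AbsRing}.

Lemma is_series_inj (u : nat -> V) l1 l2 : is_series u l1 -> is_series u l2 -> l1 = l2.
Proof. apply (filterlim_locally_unique (F := eventually)). Qed.

Lemma is_series_decr_zero (u : nat -> V) l :
  u 0%nat = zero -> is_series (fun k => u (S k)) l -> is_series u l.
Proof.
intros h0 h. apply is_series_decr_1.
assert (e : plus l (opp (u 0%nat)) = l).
{ rewrite h0. transitivity (plus l zero); [| apply plus_zero_r].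
  apply (f_equal (plus l)). apply (opp_zero (G := V)). }
now rewrite e.
Qed.

Lemma is_series_single (u : nat -> V) m :
  (forall k, k <> m -> u k = zero) -> is_series u (u m).
Proof.
intros hu.
assert (hlt : forall n, (n < m)%nat -> sum_n u n = zero).
{ induction n as [| n IH]; intros hn.
  - rewrite sum_O. apply hu. lia.
  - rewrite sum_Sn, IH, hu by lia. apply (plus_zero_r (G := V)). }
assert (hge : forall j, sum_n u (m + j) = u m).
{ induction j as [| j IH].
  - rewrite Nat.add_0_r. destruct m as [| m']; [apply sum_O |].
    rewrite sum_Sn, hlt by lia. apply (plus_zero_l (G := V)).
  - rewrite Nat.add_succ_r, sum_Sn, IH, (hu (S (m + j))) by lia. apply (plus_zero_r (G := V)). }
apply filterlim_ext_loc with (fun _ => u m); [| apply filterlim_const].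
exists m. intros n hn. replace n with (m + (n - m))%nat by lia. now rewrite hge.
Qed.

Lemma norm_filterlim_le (u : nat -> V) l (r : R) :
  filterlim u eventually (locally l) -> eventually (fun n => norm (u n) <= r) -> norm l <= r.
Proof.
intros h hr.
refine (filterlim_le (F := eventually) (fun n => norm (u n)) (fun _ => r) (norm l) r hr _ _).
- apply filterlim_comp with (1 := h). apply filterlim_norm.
- apply filterlim_const.
Qed.

Variables (u : nat -> V) (b : nat -> R) (l : V) (s : R).
Hypothesis hu : is_series u l.
Hypothesis hb : is_series b s.
Hypothesis hub : forall n, norm (u n) <= b n.

Lemma sum_n_le_series n : sum_n b n <= s.
Proof.
assert (h : is_lim_seq (sum_n b) s) by exact hb.
apply (is_lim_seq_incr_compare _ _ h). intros m. rewrite sum_Sn.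
assert (0 <= b (S m)) by (apply Rle_trans with (2 := hub (S m)); apply norm_ge_0).
unfold plus; cbn. lra.
Qed.

Lemma norm_series_le : norm l <= s.
Proof.
apply norm_filterlim_le with (1 := hu). exists 0%nat. intros n _.
apply Rle_trans with (2 := sum_n_le_series n).
apply Rle_trans with (1 := norm_sum_n_m u 0 n). apply sum_n_m_le, hub.
Qed.

(** The bound depends on the majorant alone, hence it is uniform over a family of series sharing
    that majorant; termwise integration relies on this. *)
Lemma norm_series_tail_le n : norm (minus l (sum_n u n)) <= s - sum_n b n.
Proof.
apply norm_filterlim_le with (fun m => minus (sum_n u m) (sum_n u n)).
- unfold minus. apply (filterlim_comp_2 (F := eventually) (G := locally l)
    (H := locally (opp (sum_n u n)))).
  + exact hu.
  + apply filterlim_const.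
  + apply filterlim_plus.
- exists n. intros m hm.
  replace (minus (sum_n u m) (sum_n u n)) with (sum_n_m u (S n) m)
    by apply (sum_n_m_sum_n u n m hm).
  apply Rle_trans with (1 := norm_sum_n_m u (S n) m).
  apply Rle_trans with (sum_n_m b (S n) m); [apply sum_n_m_le, hub |].
  apply Rle_trans with (sum_n b m - sum_n b n).
  + right. apply (sum_n_m_sum_n (G := R_AbelianGroup) b n m hm).
  + assert (h := sum_n_le_series m). lra.
Qed.

End Normed_series.

(** A second-order remainder can be estimated term by term in a power series and then summed, which
    the little-o definition of the derivative does not allow directly. *)
Lemma is_derive_quadratic {V : NormedModule R_AbsRing} (f : R -> V) x l K :
  locally x (fun y => norm (minus (minus (f y) (f x)) (scal (y - x) l)) <= K * (y - x) ^ 2) ->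
  is_derive f x l.
Proof.
intros h. split; [apply is_linear_scal_l |].
intros x0 hx0. rewrite <- (is_filter_lim_locally_unique _ _ hx0). intros eps.
assert (hd : 0 < eps / (Rabs K + 1)).
{ apply Rdiv_lt_0_compat; [apply cond_pos |]. assert (e := Rabs_pos K). lra. }
assert (hball : locally x (fun y => Rabs (y - x) < eps / (Rabs K + 1)))
  by (exists (mkposreal _ hd); intros y hy; exact hy).
generalize (filter_and _ _ h hball). apply filter_imp. intros y [h1 h2].
apply Rle_trans with (1 := h1). change (norm (minus y x)) with (Rabs (y - x)).
assert (hK := Rabs_pos K). assert (hK' := Rle_abs K).
replace ((y - x) ^ 2) with (Rabs (y - x) * Rabs (y - x)) by (rewrite <- Rabs_mult, Rabs_pos_eq; [ring | apply Rle_0_sqr]).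
rewrite <- Rmult_assoc. apply Rmult_le_compat_r; [apply Rabs_pos |].
apply Rle_trans with ((Rabs K + 1) * Rabs (y - x)).
- apply Rmult_le_compat_r; [apply Rabs_pos | lra].
- apply Rle_trans with ((Rabs K + 1) * (eps / (Rabs K + 1))).
  + apply Rmult_le_compat_l; lra.
  + right. field. lra.
Qed.

Lemma INR_le_pow_2 n : INR (S n) <= 2 ^ S n.
Proof.
induction n as [| n IH]; [cbn; lra |].
rewrite S_INR. rewrite <- tech_pow_Rmult.
assert (1 <= 2 ^ S n) by (apply pow_R1_Rle; lra). lra.
Qed.

(** The remainder obeys [D' = y D + (k + 1) x^k (y - x)^2]. The constant [(2 r)^(k + 1)] is crude:
    the factor [2^(k + 1)] absorbs the polynomial in [k], and a geometric bound suffices against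
    entire coefficients. *)
Lemma pow_taylor_1_le x y r k : 1 <= r -> Rabs x <= r -> Rabs y <= r ->
  Rabs (y ^ S k - x ^ S k - INR (S k) * x ^ k * (y - x)) <= (2 * r) ^ S k * (y - x) ^ 2.
Proof.
intros hr hx hy. induction k as [| k IH].
- cbn. replace (y * 1 - x * 1 - 1 * 1 * (y - x)) with 0 by ring. rewrite Rabs_R0.
  apply Rmult_le_pos; [lra |]. rewrite Rmult_1_r. apply Rle_0_sqr.
- set (D := y ^ S k - x ^ S k - INR (S k) * x ^ k * (y - x)) in *.
  replace (y ^ S (S k) - x ^ S (S k) - INR (S (S k)) * x ^ S k * (y - x)) with
    (y * D + INR (S k) * x ^ k * (y - x) ^ 2)
    by (unfold D; rewrite (S_INR (S k)); cbn [pow]; ring).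
  apply Rle_trans with (1 := Rabs_triang _ _). rewrite !Rabs_mult.
  assert (h2 := pow2_ge_0 (y - x)).
  rewrite (Rabs_pos_eq ((y - x) ^ 2)) by auto.
  rewrite (Rabs_pos_eq (INR (S k))) by apply pos_INR.
  assert (hxk : Rabs (x ^ k) <= r ^ k).
  { rewrite <- RPow_abs. apply pow_incr. split; [apply Rabs_pos | auto]. }
  assert (h3 : Rabs y * Rabs D <= r * ((2 * r) ^ S k * (y - x) ^ 2)).
  { apply Rmult_le_compat; auto; apply Rabs_pos. }
  assert (h4 : INR (S k) * Rabs (x ^ k) <= r * (2 * r) ^ S k).
  { rewrite Rpow_mult_distr. apply Rle_trans with (2 ^ S k * r ^ k).
    - apply Rmult_le_compat; auto; [apply pos_INR | apply Rabs_pos | apply INR_le_pow_2].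
    - assert (0 < 2 ^ S k) by (apply pow_lt; lra).
      assert (0 < r ^ k) by (apply pow_lt; lra).
      rewrite <- (tech_pow_Rmult r k).
      replace (r * (2 ^ S k * (r * r ^ k))) with (2 ^ S k * r ^ k * (r * r)) by ring.
      rewrite <- (Rmult_1_r (2 ^ S k * r ^ k)) at 1.
      apply Rmult_le_compat_l; [apply Rmult_le_pos; lra |].
      clear - hr. nra. }
  apply Rle_trans with (r * ((2 * r) ^ S k * (y - x) ^ 2) + r * (2 * r) ^ S k * (y - x) ^ 2).
  + apply Rplus_le_compat; auto. apply Rmult_le_compat_r; auto.
  + right. cbn [pow]. ring.
Qed.

Section Entire.

Context {V : CompleteNormedModule R_AbsRing}.

(** The vector analogue of an infinite radius of convergence. Doubling the radius costs nothing,
    which makes the crude constants of the remainder estimates harmless. *)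
Definition entire (a : nat -> V) : Prop :=
  forall r, 0 <= r -> ex_series (fun k => norm (a k) * r ^ k).

Definition vpow (a : nat -> V) (x : R) : V := iota (is_series (fun k => scal (x ^ k) (a k))).

Definition vpow_derive_coef (a : nat -> V) (k : nat) : V := scal (INR (S k)) (a (S k)).

Lemma norm_scal_pow (a : nat -> V) x r k : Rabs x <= r ->
  norm (scal (x ^ k) (a k)) <= norm (a k) * r ^ k.
Proof.
intros hx. apply Rle_trans with (1 := norm_scal (x ^ k) (a k)).
rewrite Rmult_comm. apply Rmult_le_compat_l; [apply norm_ge_0 |].
change (Rabs (x ^ k) <= r ^ k).
rewrite <- RPow_abs. apply pow_incr. split; [apply Rabs_pos | auto].
Qed.

Lemma vpow_correct (a : nat -> V) x : entire a ->
  is_series (fun k => scal (x ^ k) (a k)) (vpow a x).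
Proof.
intros ha.
destruct (ex_series_le (fun k => scal (x ^ k) (a k)) (fun k => norm (a k) * Rabs x ^ k))
  as [l hl].
- intros k. apply norm_scal_pow. lra.
- apply ha, Rabs_pos.
- apply (iota_correct (is_series (fun k => scal (x ^ k) (a k)))). exists l. split; auto. intros l'. now apply is_series_inj.
Qed.

Lemma entire_derive_coef (a : nat -> V) : entire a -> entire (vpow_derive_coef a).
Proof.
intros ha r hr.
(* The factor [k + 1] is absorbed by [2^(k + 1)]; taking [r + 1] in place of [r] allows one more
   power, so the majorant is a shift of the series at radius [2 (r + 1)]. *)
apply (ex_series_le (V := R_CompleteNormedModule)) with
  (fun k => norm (a (S k)) * (2 * (r + 1)) ^ S k).
- intros k. change (Rabs (norm (vpow_derive_coef a k) * r ^ k) <=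
    norm (a (S k)) * (2 * (r + 1)) ^ S k).
  assert (hrk : 0 <= r ^ k) by (apply pow_le; auto).
  rewrite Rabs_pos_eq by (apply Rmult_le_pos; auto; apply norm_ge_0).
  assert (hn := norm_scal (INR (S k)) (a (S k))).
  change (abs (INR (S k))) with (Rabs (INR (S k))) in hn.
  rewrite Rabs_pos_eq in hn by apply pos_INR.
  apply Rle_trans with (INR (S k) * norm (a (S k)) * r ^ k).
  { apply Rmult_le_compat_r; auto. }
  replace (INR (S k) * norm (a (S k)) * r ^ k) with
    (norm (a (S k)) * (INR (S k) * r ^ k)) by ring.
  apply Rmult_le_compat_l; [apply norm_ge_0 |]. rewrite Rpow_mult_distr.
  apply Rmult_le_compat; auto; [apply pos_INR | apply INR_le_pow_2 |].
  apply Rle_trans with ((r + 1) ^ k); [apply pow_incr; lra |].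
  apply Rle_pow; [lra | lia].
- apply (ex_series_incr_1 (fun k => norm (a k) * (2 * (r + 1)) ^ k)). apply ha. lra.
Qed.

(** The first-order Taylor remainders of the monomials are summed. For [y] within 1 of [x] both
    points lie in the ball of radius [r], and the quadratic constant is the sum of the absolute
    series at [2 r]. *)
Lemma is_derive_vpow (a : nat -> V) x : entire a ->
  is_derive (vpow a) x (vpow (vpow_derive_coef a) x).
Proof.
intros ha. set (r := Rabs x + 1).
assert (hr : 1 <= r) by (unfold r; assert (h := Rabs_pos x); lra).
destruct (ha (2 * r)) as [K hK]; [lra |].
apply is_derive_quadratic with (K := K).
exists (mkposreal 1 Rlt_0_1). intros y hy.
assert (hy' : Rabs y <= r).
{ change (Rabs (y - x) < 1) in hy. unfold r.
  replace y with (x + (y - x)) by ring. apply Rle_trans with (1 := Rabs_triang _ _). lra. }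
assert (hs : is_series (fun k => scal (y ^ k - x ^ k - INR k * x ^ pred k * (y - x)) (a k))
  (minus (minus (vpow a y) (vpow a x)) (scal (y - x) (vpow (vpow_derive_coef a) x)))).
{ assert (h1 := vpow_correct a y ha). assert (h2 := vpow_correct a x ha).
  assert (h3 := vpow_correct _ x (entire_derive_coef a ha)).
  (* Reindexing by [pred] aligns the derivative series with the original one; the junk power at
     [k = 0] is multiplied by [INR 0]. *)
  assert (h4 : is_series (fun k => scal (INR k * x ^ pred k) (a k))
    (vpow (vpow_derive_coef a) x)).
  { apply (is_series_decr_zero (V := V)); [cbn [INR]; rewrite Rmult_0_l; apply (scal_0_l (V := V)) |].
    apply is_series_ext with (2 := h3). intros k. cbn [pred]. unfold vpow_derive_coef.
    rewrite scal_assoc. f_equal. apply Rmult_comm. }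
  assert (h5 := is_series_minus _ _ _ _ (is_series_minus _ _ _ _ h1 h2)
    (is_series_scal (y - x) _ _ h4)).
  apply is_series_ext with (2 := h5). intros k.
  etransitivity; [apply (scal_sub_sub (V := V)) |].
  apply (f_equal (fun c => scal (c : R) (a k))). ring. }
rewrite Rmult_comm.
apply (norm_series_le _ _ _ _ hs (is_series_scal ((y - x) ^ 2) _ _ hK)).
intros k. apply Rle_trans with
  (1 := norm_scal (y ^ k - x ^ k - INR k * x ^ pred k * (y - x)) (a k)).
change (Rabs (y ^ k - x ^ k - INR k * x ^ pred k * (y - x)) * norm (a k) <=
  (y - x) ^ 2 * (norm (a k) * (2 * r) ^ k)).
replace ((y - x) ^ 2 * (norm (a k) * (2 * r) ^ k)) with
  ((2 * r) ^ k * (y - x) ^ 2 * norm (a k)) by ring.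
apply Rmult_le_compat_r; [apply norm_ge_0 |].
destruct k as [| k].
- cbn. replace (1 - 1 - 0 * 1 * (y - x)) with 0 by ring. rewrite Rabs_R0.
  apply Rmult_le_pos; [lra | apply (pow2_ge_0 (y - x))].
- apply pow_taylor_1_le; auto. unfold r; lra.
Qed.

Lemma continuous_vpow (a : nat -> V) x : entire a -> continuous (vpow a) x.
Proof.
intros ha. apply (ex_derive_continuous (V := V)). eexists. now apply is_derive_vpow.
Qed.

End Entire.

(** * Vector-valued Mittag-Leffler functions *)

Lemma rpow_pos_eq x y : 0 < x -> rpow x y = Rpower x y.
Proof. intros hx. unfold rpow. destruct (Rlt_dec 0 x); lra. Qed.

Lemma rpow_nonpos_eq x y : x <= 0 -> rpow x y = 0.
Proof. intros hx. unfold rpow. destruct (Rlt_dec 0 x); lra. Qed.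

Lemma rpow_ge_0 x y : 0 <= rpow x y.
Proof. unfold rpow. destruct (Rlt_dec 0 x); [left; apply exp_pos | lra]. Qed.

Lemma locally_gt_0 t : 0 < t -> locally t (fun s => 0 < s).
Proof.
intros ht. exists (mkposreal t ht). intros s hs.
apply Rabs_def2 in hs. cbn in hs. unfold minus, plus, opp in hs. cbn in hs. lra.
Qed.

Lemma continuous_rpow t y : 0 < y -> continuous (fun s => rpow s y) t.
Proof.
intros hy. destruct (Rlt_le_dec 0 t) as [ht | ht].
- apply continuous_ext_loc with (fun s => Rpower s y); [| now apply continuous_Rpower].
  generalize (locally_gt_0 t ht). apply filter_imp. intros s hs. now rewrite rpow_pos_eq.
- unfold continuous. rewrite rpow_nonpos_eq by auto.
  apply filterlim_locally. intros e.
  exists (mkposreal (Rpower e (/ y)) (Rpower_pos _ _)). intros s hs.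
  apply Rabs_def2 in hs. cbn in hs. unfold minus, plus, opp in hs. cbn in hs.
  assert (he := cond_pos e).
  assert (h : 0 <= rpow s y < e).
  { split; [apply rpow_ge_0 |]. destruct (Rlt_le_dec 0 s) as [h0 | h0].
    - rewrite rpow_pos_eq by auto.
      apply Rlt_le_trans with (Rpower (Rpower e (/ y)) y); [apply Rlt_Rpower_l; lra |].
      rewrite Rpower_mult, Rinv_l, Rpower_1; lra.
    - rewrite rpow_nonpos_eq; auto. }
  apply Rabs_def1; unfold minus, plus, opp; cbn; lra.
Qed.

Lemma Rpower_INR_mult x g k : Rpower x (INR k * g) = Rpower x g ^ k.
Proof.
rewrite Rmult_comm, <- Rpower_mult. apply Rpower_pow, Rpower_pos.
Qed.

Section Mittag_Leffler.

Variable gamma : R.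
Hypothesis hgamma : 0 < gamma < 1.

Let Gamma_arg_pos k : 0 < Gamma (INR k * gamma + 1).
Proof. apply Gamma_pos. assert (h := pos_INR k). nra. Qed.

Lemma Gamma_growth r : 0 <= r ->
  exists C, 0 < C /\ forall k, r ^ k / Gamma (INR k * gamma + 1) <= C * (1 / 2) ^ k.
Proof.
(* With this point [p] the power [p^(k gamma)] in the lower bound for Gamma equals [(2 (r + 1))^k],
   which beats [r^k] by the factor [2^k]. *)
intros hr. set (p := Rpower (2 * (r + 1)) (/ gamma)).
exists (exp (p + 1)). split; [apply exp_pos |]. intros k.
assert (hk : 0 <= INR k * gamma) by (assert (h := pos_INR k); nra).
assert (h := Gamma_S_ge (INR k * gamma) p hk (Rpower_pos _ _)).
assert (e : Rpower p (INR k * gamma) = (2 * (r + 1)) ^ k).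
{ rewrite Rpower_INR_mult. unfold p. rewrite Rpower_mult, Rinv_l, Rpower_1; lra. }
rewrite e, exp_Ropp in h.
assert (hG := Gamma_arg_pos k). assert (hp := exp_pos (p + 1)).
apply Rmult_le_reg_r with (Gamma (INR k * gamma + 1)); auto.
unfold Rdiv. rewrite (Rmult_assoc (r ^ k)), Rinv_l, Rmult_1_r by lra.
apply Rle_trans with (exp (p + 1) * (1 * / 2) ^ k * ((2 * (r + 1)) ^ k * / exp (p + 1))).
- replace (exp (p + 1) * (1 * / 2) ^ k * ((2 * (r + 1)) ^ k * / exp (p + 1))) with
    ((1 * / 2) ^ k * (2 * (r + 1)) ^ k) by (field; lra).
  rewrite <- Rpow_mult_distr. apply pow_incr. lra.
- apply Rmult_le_compat_l; auto.
  apply Rmult_le_pos; [lra |]. apply pow_le. lra.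
Qed.

Section Vector.

Context {V : CompleteNormedModule R_AbsRing}.

(** The growth of [(- B)^k v] for a bounded operator [B], with [M] in the role of the operator
    norm. *)
Definition geometrically_bounded (c : nat -> V) : Prop :=
  exists C M, 0 <= C /\ 0 <= M /\ forall k, norm (c k) <= C * M ^ k.

Definition ml_coef (c : nat -> V) (k : nat) : V := scal (/ Gamma (INR k * gamma + 1)) (c k).

Lemma entire_ml_coef c : geometrically_bounded c -> entire (ml_coef c).
Proof.
intros [C [M [hC [hM hc]]]] r hr.
destruct (Gamma_growth (M * r)) as [K [hK hg]]; [nra |].
apply (ex_series_le (V := R_CompleteNormedModule)) with (fun k => C * K * (1 / 2) ^ k).
- intros k. change (Rabs (norm (ml_coef c k) * r ^ k) <= C * K * (1 / 2) ^ k).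
  assert (hrk : 0 <= r ^ k) by (apply pow_le; auto).
  rewrite Rabs_pos_eq by (apply Rmult_le_pos; auto; apply norm_ge_0).
  assert (hn := norm_scal (/ Gamma (INR k * gamma + 1)) (c k)).
  change (abs (/ Gamma (INR k * gamma + 1))) with (Rabs (/ Gamma (INR k * gamma + 1))) in hn.
  assert (hi := Rinv_0_lt_compat _ (Gamma_arg_pos k)).
  rewrite Rabs_pos_eq in hn by lra.
  apply Rle_trans with (/ Gamma (INR k * gamma + 1) * (C * M ^ k) * r ^ k).
  + apply Rmult_le_compat_r; auto. apply Rle_trans with (1 := hn).
    apply Rmult_le_compat_l; [lra | auto].
  + replace (/ Gamma (INR k * gamma + 1) * (C * M ^ k) * r ^ k) with
      (C * ((M * r) ^ k / Gamma (INR k * gamma + 1))) by (rewrite Rpow_mult_distr; unfold Rdiv; ring).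
    rewrite Rmult_assoc. apply Rmult_le_compat_l; auto.
- apply (ex_series_scal (V := R_NormedModule)).
  apply ex_series_geom. rewrite Rabs_pos_eq; lra.
Qed.

Lemma geometrically_bounded_shift c :
  geometrically_bounded c -> geometrically_bounded (fun k => c (S k)).
Proof.
intros [C [M [hC [hM hc]]]]. exists (C * M), M. repeat split; auto; [nra |].
intros k. apply Rle_trans with (1 := hc (S k)). right. cbn [pow]. ring.
Qed.

(** For [c k = B^k v] this is [E_gamma (t^gamma B) v]. Since [rpow] vanishes at 0, the value there
    is [c 0], whereas [Rpower 0 gamma] would be 1; the function is constant on the left of 0 and so
    continuous everywhere. *)
Definition ml_fun (c : nat -> V) (t : R) : V := vpow (ml_coef c) (rpow t gamma).

Definition ml_fun_derive (c : nat -> V) (t : R) : V :=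
  scal (gamma * Rpower t (gamma - 1))
    (vpow (vpow_derive_coef (ml_coef c)) (Rpower t gamma)).

Variable c : nat -> V.
Hypothesis hc : geometrically_bounded c.

Let ha : entire (ml_coef c) := entire_ml_coef c hc.
Let hda : entire (vpow_derive_coef (ml_coef c)) := entire_derive_coef _ ha.

Lemma ml_fun_correct t :
  is_series (fun k => scal (rpow t gamma ^ k) (ml_coef c k)) (ml_fun c t).
Proof. apply vpow_correct, ha. Qed.

Lemma ml_fun_0 : ml_fun c 0 = c 0%nat.
Proof.
assert (h := ml_fun_correct 0). rewrite rpow_nonpos_eq in h by lra.
assert (h0 : forall k, k <> 0%nat -> scal (0 ^ k) (ml_coef c k) = zero).
{ intros k hk. rewrite pow_i by lia. apply (scal_0_l (V := V)). }
rewrite (is_series_inj _ _ _ h (is_series_single (V := V) _ 0%nat h0)).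
unfold ml_coef. cbn [pow INR]. rewrite Rmult_0_l, Rplus_0_l, Gamma_1, Rinv_1.
rewrite scal_assoc. etransitivity; [| apply (scal_one (V := V))].
apply (f_equal (fun z => scal (z : R) _)). apply (mult_one_l (K := R_Ring)).
Qed.

Lemma continuous_ml_fun t : continuous (ml_fun c) t.
Proof.
apply (continuous_comp (fun s => rpow s gamma) (vpow (ml_coef c))).
- apply continuous_rpow. lra.
- apply continuous_vpow, ha.
Qed.

Lemma is_derive_ml_fun t : 0 < t -> is_derive (ml_fun c) t (ml_fun_derive c t).
Proof.
intros ht. apply is_derive_ext_loc with (fun s => vpow (ml_coef c) (Rpower s gamma)).
- generalize (locally_gt_0 t ht). apply filter_imp. intros s hs.
  unfold ml_fun. now rewrite rpow_pos_eq.
- apply (is_derive_comp (vpow (ml_coef c)) (fun s => Rpower s gamma)).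
  + apply is_derive_vpow, ha.
  + apply is_derive_Rpower, ht.
Qed.

Lemma continuous_ml_fun_derive t : 0 < t -> continuous (ml_fun_derive c) t.
Proof.
intros ht. apply (continuous_scal (V := V)).
- apply (continuous_scal_r (V := R_NormedModule) gamma (fun s => Rpower s (gamma - 1))).
  now apply continuous_Rpower.
- apply (continuous_comp (fun s => Rpower s gamma) (vpow (vpow_derive_coef (ml_coef c)))).
  + now apply continuous_Rpower.
  + apply continuous_vpow, hda.
Qed.

Lemma is_RInt_gen_sum_n {I Fa Fb} (HI : improper_interval I Fa Fb)
    (h : nat -> R -> R) (m : nat -> R) (v : nat -> V) n :
  (forall k, is_RInt_gen (h k) Fa Fb (m k)) ->
  is_RInt_gen (fun s => sum_n (fun k => scal (h k s) (v k)) n) Fa Fb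
    (sum_n (fun k => scal (m k) (v k)) n).
Proof.
assert (PFa := ii_left_proper HI). assert (PFb := ii_right_proper HI).
intros hm.
assert (h1 : forall k, is_RInt_gen (fun s => scal (h k s) (v k)) Fa Fb (scal (m k) (v k))).
{ intros k. apply (is_RInt_gen_linear (fun r : R => scal r (v k)) (is_linear_scal_l (v k)) Fa Fb (h k) (m k) (hm k)). }
induction n as [| n IH].
- rewrite sum_O. apply (is_RInt_gen_ext_on HI) with (2 := h1 0%nat).
  intros s _. now rewrite sum_O.
- rewrite sum_Sn. apply (is_RInt_gen_ext_on HI) with
    (fun s => plus (sum_n (fun k => scal (h k s) (v k)) n) (scal (h (S n) s) (v (S n)))).
  + intros s _. now rewrite sum_Sn.
  + apply (is_RInt_gen_plus (V := V)); auto.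
Qed.

Lemma continuous_sum_n (h : nat -> R -> V) n x :
  (forall k, continuous (h k) x) -> continuous (fun s => sum_n (fun k => h k s) n) x.
Proof.
intros hh. induction n as [| n IH].
- apply continuous_ext with (h 0%nat); auto. intros s. now rewrite sum_O.
- apply continuous_ext with (fun s => plus (sum_n (fun k => h k s) n) (h (S n) s)).
  + intros s. now rewrite sum_Sn.
  + apply (continuous_plus (V := V)); auto.
Qed.

(** The beta integral, rewritten with [gamma * Gamma ((k + 1) gamma) = Gamma ((k + 1) gamma + 1) /
    (k + 1)]. In this shape the last factor cancels the derived coefficient of index [k] and leaves
    the Mittag-Leffler coefficient of index [k]. *)
Lemma caputo_kernel_moment k t : 0 < t ->
  is_RInt_gen (fun s => gamma * (Rpower (t - s) (- gamma) * Rpower s (INR (S k) * gamma - 1)))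
    (at_right 0) (at_left t)
    (Gamma (1 - gamma) * / Gamma (INR k * gamma + 1) * Rpower t gamma ^ k
      * (Gamma (INR (S k) * gamma + 1) / INR (S k))).
Proof.
intros ht.
assert (hk : 0 < INR (S k) * gamma).
{ apply Rmult_lt_0_compat; [apply lt_0_INR; lia | lra]. }
assert (h := is_RInt_gen_beta_kernel (1 - gamma) ltac:(lra) (INR (S k) * gamma) t hk ht).
apply (is_RInt_gen_scal (V := R_NormedModule) _ gamma) in h;
  try apply at_right_proper_filter; try apply at_left_proper_filter.
replace (1 - gamma - 1) with (- gamma) in h by ring.
replace (Gamma (1 - gamma) * / Gamma (INR k * gamma + 1) * Rpower t gamma ^ k
      * (Gamma (INR (S k) * gamma + 1) / INR (S k))) with
  (scal gamma (Gamma (INR (S k) * gamma) * Gamma (1 - gamma) /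
     Gamma (INR (S k) * gamma + (1 - gamma)) * Rpower t (INR (S k) * gamma + (1 - gamma) - 1))).
- exact h.
- change (gamma * (Gamma (INR (S k) * gamma) * Gamma (1 - gamma) /
     Gamma (INR (S k) * gamma + (1 - gamma)) * Rpower t (INR (S k) * gamma + (1 - gamma) - 1)) =
   Gamma (1 - gamma) * / Gamma (INR k * gamma + 1) * Rpower t gamma ^ k
      * (Gamma (INR (S k) * gamma + 1) / INR (S k))).
  rewrite (Gamma_S (INR (S k) * gamma)) by auto.
  replace (INR (S k) * gamma + (1 - gamma)) with (INR k * gamma + 1) by (rewrite S_INR; ring).
  replace (INR k * gamma + 1 - 1) with (INR k * gamma) by ring.
  rewrite Rpower_INR_mult. assert (h1 := Gamma_arg_pos k).
  assert (h2 : 0 < INR (S k)) by (apply lt_0_INR; lia). field. lra.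
Qed.

(** The Caputo derivative shifts the coefficient sequence, so for [c k = B^k v] it acts as
    multiplication by [B]. *)
Lemma ml_fun_caputo t : 0 < t ->
  is_integral_open (fun s => scal (Rpower (t - s) (- gamma)) (ml_fun_derive c s)) 0 t
    (scal (Gamma (1 - gamma)) (ml_fun (fun k => c (S k)) t)).
Proof.
intros ht.
assert (HI := improper_interval_bounded 0 t ht).
set (d := vpow_derive_coef (ml_coef c)).
set (g := fun s => Rpower (t - s) (- gamma) * Rpower s (gamma - 1)).
set (x := Rpower t gamma).
(* [K] majorizes the derivative series on the whole of [(0, t)], where [s^gamma <= x]; the two
   singular factors are kept apart in [g], which is integrable by the beta integral. *)
destruct (hda x (Rlt_le _ _ (Rpower_pos _ _))) as [K hK]. fold d in hK.
assert (cker : forall s, 0 < s < t -> continuous (fun s => Rpower (t - s) (- gamma)) s).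
{ intros s hs. apply (continuous_comp (fun s => t - s) (fun s => Rpower s (- gamma))).
  - apply (ex_derive_continuous (V := R_NormedModule)). auto_derive. auto.
  - apply continuous_Rpower. lra. }
assert (cg : forall s, 0 < s < t -> continuous g s).
{ intros s hs. apply (continuous_mult (K := R_AbsRing)); auto. apply continuous_Rpower. lra. }
assert (pg : forall s, 0 <= g s).
{ intros s. apply Rmult_le_pos; left; apply Rpower_pos. }
assert (cf : forall s, 0 < s < t ->
  continuous (fun s => scal (Rpower (t - s) (- gamma)) (ml_fun_derive c s)) s).
{ intros s hs. apply (continuous_scal (V := V)); auto. apply continuous_ml_fun_derive. lra. }
assert (hg := is_RInt_gen_beta_kernel (1 - gamma) ltac:(lra) gamma t ltac:(lra) ht).
replace (1 - gamma - 1) with (- gamma) in hg by ring. fold g in hg.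
assert (hds : forall s, 0 < s < t -> forall k,
  norm (scal (Rpower s gamma ^ k) (d k)) <= norm (d k) * x ^ k).
{ intros s hs k. apply norm_scal_pow. rewrite Rabs_pos_eq by (left; apply Rpower_pos).
  apply Rle_Rpower_l; lra. }
assert (hK0 : 0 <= K).
{ apply Rle_trans with (2 := norm_series_le _ _ _ _ (vpow_correct d x hda) hK
    (fun k => norm_scal_pow d x x k ltac:(rewrite Rabs_pos_eq; [lra | left; apply Rpower_pos]))).
  apply norm_ge_0. }
assert (hfac : forall s, 0 < s < t -> forall (p q : V) (r : R), norm (minus p q) <= r ->
  norm (minus (scal (Rpower (t - s) (- gamma)) (scal (gamma * Rpower s (gamma - 1)) p))
     (scal (Rpower (t - s) (- gamma)) (scal (gamma * Rpower s (gamma - 1)) q))) <=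
  gamma * r * g s).
{ intros s hs p q r hr.
  assert (e : minus (scal (Rpower (t - s) (- gamma)) (scal (gamma * Rpower s (gamma - 1)) p))
     (scal (Rpower (t - s) (- gamma)) (scal (gamma * Rpower s (gamma - 1)) q)) =
     scal (gamma * g s) (minus p q)).
  { rewrite !scal_assoc, <- scal_minus_distr_l. apply (f_equal (fun z => scal (z : R) _)).
    unfold g, mult; cbn. ring. }
  rewrite e. apply Rle_trans with (1 := norm_scal (gamma * g s) (minus p q)).
  change (Rabs (gamma * g s) * norm (minus p q) <= gamma * r * g s).
  specialize (pg s). rewrite Rabs_pos_eq by nra.
  replace (gamma * r * g s) with (gamma * g s * r) by ring.
  apply Rmult_le_compat_l; auto. nra. }
split.
- assert (hgK := hg).
  apply (is_RInt_gen_scal (V := R_NormedModule) _ (gamma * K)) in hgK;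
    try apply at_right_proper_filter; try apply at_left_proper_filter.
  edestruct (is_RInt_gen_dominated HI
    (fun s => norm (scal (Rpower (t - s) (- gamma)) (ml_fun_derive c s))))
    with (4 := hgK) as [l [hl _]]; [| | | exists l; exact hl].
  + intros s hs. apply (filterlim_comp _ _ _ _ norm _ _ _ (cf s hs) (filterlim_norm (V := V) _)).
  + intros s hs. apply (continuous_scal_r (V := R_NormedModule)); auto.
  + intros s hs. split; [apply norm_ge_0 |].
    change (norm (scal (Rpower (t - s) (- gamma)) (ml_fun_derive c s)) <= gamma * K * g s).
    assert (h1 := norm_series_le _ _ _ _ (vpow_correct d (Rpower s gamma) hda) hK (hds s hs)).
    assert (h2 := norm_scal (Rpower (t - s) (- gamma)) (ml_fun_derive c s)).
    assert (h3 := norm_scal (gamma * Rpower s (gamma - 1)) (vpow d (Rpower s gamma))).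
    change (norm (ml_fun_derive c s) <=
      Rabs (gamma * Rpower s (gamma - 1)) * norm (vpow d (Rpower s gamma))) in h3.
    apply Rle_trans with (1 := h2).
    change (Rabs (Rpower (t - s) (- gamma)) * norm (ml_fun_derive c s) <= gamma * K * g s).
    assert (p1 := Rpower_pos (t - s) (- gamma)). assert (p2 := Rpower_pos s (gamma - 1)).
    rewrite Rabs_pos_eq in h3 by nra. rewrite Rabs_pos_eq by lra.
    replace (gamma * K * g s) with
      (Rpower (t - s) (- gamma) * (gamma * Rpower s (gamma - 1) * K)) by (unfold g; ring).
    apply Rmult_le_compat_l; [lra |]. apply Rle_trans with (1 := h3).
    apply Rmult_le_compat_l; [nra | exact h1].
(* Relative to [g] the remainder after [n] terms is at most [gamma] times the tail of [K], uniformly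
   in [s], although the integrands themselves are unbounded. *)
- apply (is_RInt_gen_rel_unif HI
    (fun n s => scal (Rpower (t - s) (- gamma)) (scal (gamma * Rpower s (gamma - 1))
       (sum_n (fun k => scal (Rpower s gamma ^ k) (d k)) n)))
    _ g (fun n => gamma * (K - sum_n (fun k => norm (d k) * x ^ k) n))
    (fun n => scal (Gamma (1 - gamma))
       (sum_n (fun k => scal (rpow t gamma ^ k) (ml_coef (fun k => c (S k)) k)) n)) _ _) with (5 := hg); auto.
  + intros n s hs. apply (continuous_scal (V := V)); auto. apply (continuous_scal (V := V)).
    * apply (continuous_scal_r (V := R_NormedModule) gamma (fun s => Rpower s (gamma - 1))).
      apply continuous_Rpower; lra.
    * apply (continuous_sum_n (fun k s => scal (Rpower s gamma ^ k) (d k))).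
      intros k. apply (continuous_scal_l (V := V) (fun s => Rpower s gamma ^ k)).
      apply continuous_ext with (fun s => Rpower s (INR k * gamma)).
      -- intros; apply Rpower_INR_mult.
      -- apply continuous_Rpower; lra.
  + intros n s hs. apply hfac; auto.
    apply (norm_series_tail_le _ _ _ _ (vpow_correct d (Rpower s gamma) hda) hK).
    apply hds, hs.
  + assert (hK' : is_lim_seq (sum_n (fun k => norm (d k) * x ^ k)) K) by exact hK.
    replace (Finite 0) with (Rbar_mult gamma (K - K)) by (cbn; f_equal; ring).
    apply is_lim_seq_scal_l. apply is_lim_seq_minus'; auto. apply is_lim_seq_const.
  + intros n.
    assert (h1 := is_RInt_gen_sum_n HI
      (fun k s => gamma * (Rpower (t - s) (- gamma) * Rpower s (INR (S k) * gamma - 1))) _ d n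
      (fun k => caputo_kernel_moment k t ht)).
    replace (scal (Gamma (1 - gamma))
       (sum_n (fun k => scal (rpow t gamma ^ k) (ml_coef (fun k => c (S k)) k)) n)) with
      (sum_n (fun k => scal (Gamma (1 - gamma) * / Gamma (INR k * gamma + 1)
        * Rpower t gamma ^ k * (Gamma (INR (S k) * gamma + 1) / INR (S k))) (d k)) n).
    * apply (is_RInt_gen_ext_on HI) with (2 := h1). intros s hs.
      rewrite <- !sum_n_scal_l. apply sum_n_ext. intros k.
      rewrite !scal_assoc. apply (f_equal (fun z => scal (z : R) _)). unfold mult; cbn. rewrite <- Rpower_INR_mult.
      change (match k with 0%nat => 1 | S _ => INR k + 1 end) with (INR (S k)).
      rewrite S_INR.
      replace ((INR k + 1) * gamma - 1) with ((gamma - 1) + INR k * gamma) by ring.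
      rewrite Rpower_plus. ring.
    * rewrite <- sum_n_scal_l. apply sum_n_ext. intros k.
      unfold d, vpow_derive_coef, ml_coef. rewrite rpow_pos_eq by auto.
      rewrite !scal_assoc. apply (f_equal (fun z => scal (z : R) _)).
      assert (h2 := Gamma_arg_pos k). assert (h3 := Gamma_arg_pos (S k)).
      assert (h4 : 0 < INR (S k)) by (apply lt_0_INR; lia).
      change (Gamma (1 - gamma) * / Gamma (INR k * gamma + 1) * Rpower t gamma ^ k *
        (Gamma (INR (S k) * gamma + 1) / INR (S k)) * INR (S k) *
        / Gamma (INR (S k) * gamma + 1) =
        Gamma (1 - gamma) * Rpower t gamma ^ k * / Gamma (INR k * gamma + 1)).
      field. lra.
  + apply (filterlim_comp _ _ _ _ (fun v => scal (Gamma (1 - gamma)) v) _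
      (locally (ml_fun (fun k => c (S k)) t))).
    * apply vpow_correct, entire_ml_coef, geometrically_bounded_shift, hc.
    * apply (filterlim_scal_r (V := V)).
Qed.

End Vector.

End Mittag_Leffler.

(** * Extremum principle and fractional relaxation *)

(* Integration by parts: [(t - s)^(- gamma) z'(s)] dominates the derivative of
   [(t - s)^(- gamma) (z s - z t)], which vanishes as [s] tends to [t]. *)
Lemma caputo_extremum gamma (z dz : R -> R) t l :
  0 < gamma < 1 -> 0 < t ->
  (forall s, 0 < s <= t -> is_derive z s (dz s)) ->
  (forall s, 0 < s < t -> continuous dz s) ->
  filterlim z (at_right 0) (locally (z 0)) ->
  is_RInt_gen (fun s => Rpower (t - s) (- gamma) * dz s) (at_right 0) (at_left t) l ->
  (forall s, 0 <= s <= t -> z s <= z t) ->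
  Rpower t (- gamma) * (z t - z 0) <= l.
Proof.
intros hgamma ht hd hc h0 hl hmax.
assert (HI := improper_interval_bounded 0 t ht).
assert (PFa := ii_left_proper HI). assert (PFb := ii_right_proper HI).
assert (cker : forall s, 0 < s < t -> continuous (fun s => Rpower (t - s) (- gamma)) s).
{ intros s hs. apply (continuous_comp (fun s => t - s) (fun s => Rpower s (- gamma))).
  - apply (ex_derive_continuous (V := R_NormedModule)). auto_derive. auto.
  - apply continuous_Rpower. lra. }
assert (cf : forall s, 0 < s < t -> continuous (fun s => Rpower (t - s) (- gamma) * dz s) s).
{ intros s hs. apply (continuous_mult (K := R_AbsRing)); auto. }
assert (cz : forall s, 0 < s <= t -> continuous z s).
{ intros s hs. apply (ex_derive_continuous (V := R_NormedModule)). eexists; now apply hd. }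
set (G := fun s => Rpower (t - s) (- gamma) * (z s - z t)).
set (dG := fun s => Rpower (t - s) (- gamma) * dz s
  + gamma * Rpower (t - s) (- gamma - 1) * (z s - z t)).
assert (hdG : forall s, 0 < s < t -> is_derive G s (dG s)).
{ intros s hs. evar_last.
  - apply (is_derive_mult (fun s => Rpower (t - s) (- gamma)) (fun s => z s - z t)).
    + apply (is_derive_comp (fun s => Rpower s (- gamma)) (fun s => t - s)).
      * apply is_derive_Rpower. lra.
      * auto_derive; [auto | reflexivity].
    + apply (is_derive_minus (V := R_NormedModule) z (fun _ => z t)); [apply hd; lra |].
      apply (is_derive_const (V := R_NormedModule)).
    + intros; apply Rmult_comm.
  - unfold plus, minus, mult, scal, opp, zero; cbn; unfold mult; cbn. unfold dG. ring. }
assert (cdG : forall s, 0 < s < t -> continuous dG s).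
{ intros s hs. apply (continuous_plus (V := R_NormedModule)); auto.
  apply (continuous_mult (K := R_AbsRing)).
  - apply (continuous_scal_r (V := R_NormedModule) gamma (fun s => Rpower (t - s) (- gamma - 1))).
    apply (continuous_comp (fun s => t - s) (fun s => Rpower s (- gamma - 1))).
    + apply (ex_derive_continuous (V := R_NormedModule)). auto_derive. auto.
    + apply continuous_Rpower. lra.
  - apply (continuous_minus (V := R_NormedModule)); [apply cz; lra | apply continuous_const]. }
apply (is_RInt_gen_filterlim HI (V := R_CompleteNormedModule)) in hl; auto.
refine (filterlim_le (F := filter_prod (at_right 0) (at_left t))
  (fun ab => minus (G (snd ab)) (G (fst ab))) _
  (Rpower t (- gamma) * (z t - z 0)) l _ _ hl).
- generalize (ii_eventually HI). apply filter_imp. intros [a b] [ha [hb hab]].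
  cbn [fst snd] in *.
  assert (e : is_RInt dG a b (minus (G b) (G a))).
  { apply (is_RInt_derive (V := R_CompleteNormedModule) G dG);
    intros x hx; rewrite Rmin_left, Rmax_right in hx by auto.
    - apply hdG. lra.
    - apply cdG. lra. }
  rewrite <- (is_RInt_unique (V := R_CompleteNormedModule) _ _ _ _ e).
  apply RInt_le; auto.
  + eexists; exact e.
  + apply (ii_ex_RInt HI (V := R_CompleteNormedModule)); auto.
  + intros s hs. unfold dG. specialize (hmax s ltac:(lra)).
    assert (h1 := Rpower_pos (t - s) (- gamma - 1)).
    assert (0 <= gamma * Rpower (t - s) (- gamma - 1)) by nra. nra.
- replace (Rpower t (- gamma) * (z t - z 0)) with
    (minus 0 (Rpower (t - 0) (- gamma) * (z 0 - z t)))
    by (rewrite Rminus_0_r; unfold minus, plus, opp; cbn; ring).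
  apply (filterlim_comp_2 (G := locally (0 : R))
    (H := locally (opp (Rpower (t - 0) (- gamma) * (z 0 - z t))))
    (fun ab : R * R => G (snd ab)) (fun ab : R * R => opp (G (fst ab))) plus).
  + apply filterlim_comp with (1 := filterlim_snd).
    destruct (hd t ltac:(lra)) as [_ hdt].
    (* Differentiability at [t], used with tolerance 1, gives [|z s - z t| <= K (t - s)] near [t].
       Hence the boundary term is of order [(t - s)^(1 - gamma)] and disappears because
       [gamma < 1]. *)
    specialize (hdt t (fun P h => h) (mkposreal 1 Rlt_0_1)).
    set (K := Rabs (dz t) + 1) in *.
    assert (hK : 0 < K) by (unfold K; assert (h := Rabs_pos (dz t)); lra).
    assert (hlim : filterlim (fun s => K * Rpower (t - s) (1 - gamma)) (at_left t) (locally 0)).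
    { replace 0 with (K * 0) by ring.
      apply (filterlim_comp _ _ _ _ (fun r => K * r) _ (locally 0)).
      - apply (filterlim_comp _ _ _ (fun s => t - s) (fun r => Rpower r (1 - gamma)) _ (at_right 0)).
        + intros P [e he]. exists e. intros s hs hst. apply he; [| lra].
          apply Rabs_def2 in hs. cbn in hs. unfold minus, plus, opp in hs. cbn in hs.
          apply Rabs_def1; unfold minus, plus, opp; cbn; lra.
        + apply filterlim_Rpower_0. lra.
      - apply (filterlim_scal_r (V := R_NormedModule)). }
    assert (hlim' : filterlim (fun s => - (K * Rpower (t - s) (1 - gamma))) (at_left t) (locally 0)).
    { replace 0 with (- 0) by ring. apply (filterlim_comp _ _ _ _ Ropp _ _ _ hlim).
      apply (filterlim_opp (V := R_NormedModule)). }
    refine (filterlim_le_le (F := at_left t) _ _ _ 0 _ hlim' hlim).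
    generalize (filter_and _ _ (ii_right HI) (filter_le_within (F := locally t) (fun s => s < t) _ hdt)).
    apply filter_imp. intros s [hs h1].
    change (Rabs (z s - z t - (s - t) * dz t) <= 1 * Rabs (s - t)) in h1.
    assert (h2 : Rabs (z s - z t) <= K * (t - s)).
    { replace (z s - z t) with ((z s - z t - (s - t) * dz t) + (s - t) * dz t) by ring.
      apply Rle_trans with (1 := Rabs_triang _ _). rewrite Rabs_mult.
      replace (Rabs (s - t)) with (t - s) in * by (rewrite Rabs_left; lra).
      unfold K. lra. }
    replace (1 - gamma) with (- gamma + 1) by ring. rewrite Rpower_plus, Rpower_1 by lra.
    assert (hp := Rpower_pos (t - s) (- gamma)). unfold G.
    apply Rabs_le_between in h2. split.
    * apply Rle_trans with (Rpower (t - s) (- gamma) * - (K * (t - s))); [right; ring |].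
      apply Rmult_le_compat_l; lra.
    * apply Rle_trans with (Rpower (t - s) (- gamma) * (K * (t - s))); [| right; ring].
      apply Rmult_le_compat_l; lra.
  + apply (filterlim_comp _ _ _ (fun ab : R * R => G (fst ab)) opp _
      (locally (Rpower (t - 0) (- gamma) * (z 0 - z t)))).
    * apply (filterlim_comp _ _ _ fst (fun a => Rpower (t - a) (- gamma) * (z a - z t))
        _ (at_right 0) _ filterlim_fst).
      apply (filterlim_comp_2 (F := at_right 0) (G := locally (Rpower (t - 0) (- gamma)))
        (H := locally (z 0 - z t))).
      -- apply (continuous_at_right (fun s => Rpower (t - s) (- gamma)) 0).
         apply (continuous_comp (fun s => t - s) (fun s => Rpower s (- gamma))).
         ++ apply (ex_derive_continuous (V := R_NormedModule)). auto_derive. auto.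
         ++ apply continuous_Rpower. lra.
      -- apply (filterlim_comp_2 (F := at_right 0) (G := locally (z 0)) (H := locally (- z t))
            z (fun _ => - z t) Rplus); auto.
         ++ apply filterlim_const.
         ++ apply (filterlim_plus (V := R_NormedModule) (z 0) (- z t)).
      -- apply (filterlim_mult (K := R_AbsRing)).
    * apply (filterlim_opp (V := R_NormedModule)).
  + apply (filterlim_plus (V := R_NormedModule) 0).
Qed.

(** The scalar equation [d^gamma z + mu z = 0] on [(0, S)], cleared of the factor
    [/ Gamma (1 - gamma)]. At 0 only the right limit of [z] is prescribed, since [dz] may be
    singular there. *)
Record is_relaxation (gamma mu S : R) (z dz : R -> R) : Prop := {
  relax_0 : filterlim z (at_right 0) (locally (z 0));
  relax_derive : forall t, 0 < t < S -> is_derive z t (dz t);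
  relax_continuous : forall t, 0 < t < S -> continuous dz t;
  relax_caputo : forall t, 0 < t < S ->
    is_RInt_gen (fun s => Rpower (t - s) (- gamma) * dz s) (at_right 0) (at_left t)
      (- (mu * Gamma (1 - gamma) * z t))
}.

Lemma is_relaxation_lin gamma mu S z1 dz1 z2 dz2 a b :
  is_relaxation gamma mu S z1 dz1 -> is_relaxation gamma mu S z2 dz2 ->
  is_relaxation gamma mu S (fun t => a * z1 t + b * z2 t) (fun t => a * dz1 t + b * dz2 t).
Proof.
intros h1 h2. split.
- apply (filterlim_comp_2 (F := at_right 0) (G := locally (a * z1 0)) (H := locally (b * z2 0))).
  + apply (filterlim_comp _ _ _ _ (fun r => a * r) _ _ _ (relax_0 _ _ _ _ _ h1)).
    apply (filterlim_scal_r (V := R_NormedModule)).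
  + apply (filterlim_comp _ _ _ _ (fun r => b * r) _ _ _ (relax_0 _ _ _ _ _ h2)).
    apply (filterlim_scal_r (V := R_NormedModule)).
  + apply (filterlim_plus (V := R_NormedModule)).
- intros t ht. apply (is_derive_plus (V := R_NormedModule)); apply is_derive_scal.
  + now apply (relax_derive _ _ _ _ _ h1).
  + now apply (relax_derive _ _ _ _ _ h2).
- intros t ht. apply (continuous_plus (V := R_NormedModule));
    apply (continuous_scal_r (V := R_NormedModule)).
  + now apply (relax_continuous _ _ _ _ _ h1).
  + now apply (relax_continuous _ _ _ _ _ h2).
- intros t ht.
  assert (HI := improper_interval_bounded 0 t (proj1 ht)).
  assert (PFa := ii_left_proper HI). assert (PFb := ii_right_proper HI).
  assert (g1 := is_RInt_gen_scal (V := R_NormedModule) _ a _ (relax_caputo _ _ _ _ _ h1 t ht)).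
  assert (g2 := is_RInt_gen_scal (V := R_NormedModule) _ b _ (relax_caputo _ _ _ _ _ h2 t ht)).
  assert (g := is_RInt_gen_plus (V := R_NormedModule) _ _ _ _ g1 g2).
  replace (- (mu * Gamma (1 - gamma) * (a * z1 t + b * z2 t))) with
    (plus (scal a (- (mu * Gamma (1 - gamma) * z1 t))) (scal b (- (mu * Gamma (1 - gamma) * z2 t)))).
  + apply (is_RInt_gen_ext_on HI (V := R_CompleteNormedModule)) with (2 := g).
    intros s _.
    change (a * (Rpower (t - s) (- gamma) * dz1 s) + b * (Rpower (t - s) (- gamma) * dz2 s) =
      Rpower (t - s) (- gamma) * (a * dz1 s + b * dz2 s)). ring.
  + change (a * (- (mu * Gamma (1 - gamma) * z1 t)) + b * (- (mu * Gamma (1 - gamma) * z2 t)) =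
      - (mu * Gamma (1 - gamma) * (a * z1 t + b * z2 t))). ring.
Qed.

Section Relaxation.

Variables (gamma mu S : R).
Hypothesis hgamma : 0 < gamma < 1.
Hypothesis hmu : 0 < mu.

Let hG : 0 < Gamma (1 - gamma).
Proof. apply Gamma_pos. lra. Qed.

(** At a maximum point the extremum principle bounds the Caputo integral from below and the equation
    evaluates it. The case [t0 = 0], where the equation says nothing, is left to the caller. *)
Lemma relaxation_argmax z dz t : is_relaxation gamma mu S z dz -> 0 <= t < S ->
  exists t0, 0 <= t0 <= t /\ (forall s, 0 <= s <= t -> z s <= z t0) /\
    (0 < t0 -> Rpower t0 (- gamma) * (z t0 - z 0) <= - (mu * Gamma (1 - gamma) * z t0)).
Proof.
intros hz ht.
(* The extreme value theorem wants two-sided continuity, so [z] is extended to the left of 0 by the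
   constant [z 0]. *)
destruct (continuity_ab_maj (fun s => z (Rmax 0 s)) 0 t (proj1 ht)) as [t0 [h1 h2]].
- intros s hs. apply continuity_pt_filterlim.
  destruct (Req_dec s 0) as [-> | hs0].
  + unfold continuous. rewrite Rmax_left by lra. apply filterlim_locally. intros e.
    destruct (proj1 (filterlim_locally _ _) (relax_0 _ _ _ _ _ hz) e) as [d hd].
    exists d. intros u hu. destruct (Rle_lt_dec u 0) as [h | h].
    * rewrite Rmax_left by auto. apply ball_center.
    * rewrite Rmax_right by lra. apply hd; auto.
  + apply (continuous_ext_loc (fun s => z (Rmax 0 s)) z s).
    * generalize (locally_gt_0 s ltac:(lra)). apply filter_imp. intros u hu.
      now rewrite Rmax_right by lra.
    * apply (ex_derive_continuous (V := R_NormedModule)). eexists.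
      apply (relax_derive _ _ _ _ _ hz). lra.
- exists t0. split; [auto |].
  assert (hmax : forall s, 0 <= s <= t -> z s <= z t0).
  { intros s hs. specialize (h1 s hs). now rewrite !Rmax_right in h1 by lra. }
  split; auto. intros ht0.
  apply (caputo_extremum gamma z dz); auto.
  + intros s hs. apply (relax_derive _ _ _ _ _ hz). lra.
  + intros s hs. apply (relax_continuous _ _ _ _ _ hz). lra.
  + apply (relax_0 _ _ _ _ _ hz).
  + apply (relax_caputo _ _ _ _ _ hz). lra.
  + intros s hs. apply hmax. lra.
Qed.

(** A value above [m] forces a maximum that is positive and exceeds [z 0], hence is attained at some
    [t0 > 0]; there the two sides of the maximum inequality have opposite strict signs. *)
Lemma relaxation_le z dz t m : is_relaxation gamma mu S z dz -> 0 <= t < S ->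
  0 <= m -> z 0 <= m -> z t <= m.
Proof.
intros hz ht hm h0.
destruct (relaxation_argmax z dz t hz ht) as [t0 [h1 [h2 h3]]].
apply Rnot_lt_le. intros hlt. specialize (h2 t ltac:(lra)).
destruct (Req_dec t0 0) as [e | hn]; [rewrite e in h2; lra |].
specialize (h3 ltac:(lra)).
assert (hp := Rpower_pos t0 (- gamma)).
assert (0 < Rpower t0 (- gamma) * (z t0 - z 0)) by (apply Rmult_lt_0_compat; lra).
assert (0 < mu * Gamma (1 - gamma) * z t0).
{ apply Rmult_lt_0_compat; [| lra]. now apply Rmult_lt_0_compat. }
lra.
Qed.

Lemma relaxation_unique z1 dz1 z2 dz2 t :
  is_relaxation gamma mu S z1 dz1 -> is_relaxation gamma mu S z2 dz2 ->
  z1 0 = z2 0 -> 0 <= t < S -> z1 t = z2 t.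
Proof.
intros h1 h2 h0 ht.
assert (g1 := relaxation_le _ _ t 0 (is_relaxation_lin _ _ _ _ _ _ _ 1 (-1) h1 h2) ht
  (Rle_refl 0) ltac:(lra)).
assert (g2 := relaxation_le _ _ t 0 (is_relaxation_lin _ _ _ _ _ _ _ (-1) 1 h1 h2) ht
  (Rle_refl 0) ltac:(lra)).
cbn in g1, g2. lra.
Qed.

(** The maximum inequality for [- z], encoded as the combination with coefficients [-1] and [0],
    reads [1 - z t0 <= mu * Gamma (1 - gamma) * t0^gamma * z t0] at a minimum point [t0 > 0] of [z].
    Solving for [z t0] and using [t0 <= t] gives the bound. *)
Lemma relaxation_lower z dz t : is_relaxation gamma mu S z dz -> 0 < t < S -> z 0 = 1 ->
  / (1 + mu * Gamma (1 - gamma) * Rpower t gamma) <= z t.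
Proof.
intros hz ht h0.
destruct (relaxation_argmax _ _ t (is_relaxation_lin _ _ _ _ _ _ _ (-1) 0 hz hz) ltac:(lra))
  as [t0 [h1 [h2 h3]]].
specialize (h2 t ltac:(lra)). cbn beta in h2, h3.
assert (hm : 0 < mu * Gamma (1 - gamma)) by now apply Rmult_lt_0_compat.
assert (hp := Rpower_pos t gamma).
assert (hden : 0 < mu * Gamma (1 - gamma) * Rpower t gamma) by now apply Rmult_lt_0_compat.
apply Rle_trans with (z t0); [| lra].
destruct (Req_dec t0 0) as [e | hn].
- rewrite e, h0. apply Rle_trans with (/ 1); [apply Rinv_le_contravar; lra |].
  right. apply Rinv_1.
- specialize (h3 ltac:(lra)). rewrite h0, Rpower_Ropp in h3.
  assert (hp0 := Rpower_pos t0 gamma).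
  assert (hle : Rpower t0 gamma <= Rpower t gamma) by (apply Rle_Rpower_l; lra).
  assert (h4 : 1 <= z t0 * (1 + mu * Gamma (1 - gamma) * Rpower t0 gamma)).
  { apply Rmult_le_compat_l with (r := Rpower t0 gamma) in h3; [| lra].
    rewrite <- Rmult_assoc, Rinv_r, Rmult_1_l in h3 by lra. lra. }
  assert (hd0 : 0 < 1 + mu * Gamma (1 - gamma) * Rpower t0 gamma).
  { assert (0 < mu * Gamma (1 - gamma) * Rpower t0 gamma) by now apply Rmult_lt_0_compat. lra. }
  apply Rle_trans with (/ (1 + mu * Gamma (1 - gamma) * Rpower t0 gamma)).
  + apply Rinv_le_contravar; auto. apply Rplus_le_compat_l. apply Rmult_le_compat_l; lra.
  + apply Rmult_le_reg_r with (1 + mu * Gamma (1 - gamma) * Rpower t0 gamma); auto.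
    rewrite Rinv_l by lra. exact h4.
Qed.

Definition ml_relax (t : R) : R := mittag_leffler gamma 1 (- mu * rpow t gamma).

Let powers : nat -> R_CompleteNormedModule := fun k => (- mu) ^ k.

Let powers_bounded : geometrically_bounded powers.
Proof.
exists 1, mu. repeat split; try lra. intros k.
change (Rabs ((- mu) ^ k) <= 1 * mu ^ k).
rewrite <- RPow_abs, Rabs_Ropp, Rabs_pos_eq; lra.
Qed.

(** The scalar Mittag-Leffler function is the vector-valued one over the reals, so its derivative
    and Caputo derivative are instances of the general results. *)
Lemma ml_relax_eq t : ml_relax t = ml_fun gamma powers t.
Proof.
apply (is_pseries_unique (fun k => / Gamma (INR k * gamma + 1)) (- mu * rpow t gamma)).
apply is_series_ext with (2 := ml_fun_correct gamma hgamma powers powers_bounded t).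
intros k. unfold ml_coef, powers.
change (rpow t gamma ^ k * (/ Gamma (INR k * gamma + 1) * (- mu) ^ k) =
  pow_n (- mu * rpow t gamma : R) k * / Gamma (INR k * gamma + 1)).
assert (e : pow_n (- mu * rpow t gamma : R) k = (- mu * rpow t gamma) ^ k) by apply pow_n_pow.
etransitivity; [| apply (f_equal (fun p => p * / Gamma (INR k * gamma + 1))); symmetry; exact e].
rewrite Rpow_mult_distr. ring.
Qed.

Lemma ml_relax_0 : ml_relax 0 = 1.
Proof. rewrite ml_relax_eq. apply (ml_fun_0 gamma hgamma powers powers_bounded). Qed.

Lemma is_relaxation_ml : is_relaxation gamma mu S ml_relax (ml_fun_derive gamma powers).
Proof.
assert (cE : forall t, continuous ml_relax t).
{ intros t. apply continuous_ext with (ml_fun gamma powers).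
  - intros s. now rewrite ml_relax_eq.
  - apply (continuous_ml_fun gamma hgamma powers powers_bounded). }
split.
- apply continuous_at_right, cE.
- intros t ht. apply is_derive_ext with (ml_fun gamma powers).
  + intros s. now rewrite ml_relax_eq.
  + apply (is_derive_ml_fun gamma hgamma powers powers_bounded). lra.
- intros t ht. apply (continuous_ml_fun_derive gamma hgamma powers powers_bounded). lra.
- intros t ht.
  destruct (ml_fun_caputo gamma hgamma powers powers_bounded t (proj1 ht)) as [_ h].
  replace (- (mu * Gamma (1 - gamma) * ml_relax t)) with
    (scal (Gamma (1 - gamma)) (ml_fun gamma (fun k => powers (Datatypes.S k)) t)); [exact h |].
  (* Shifting the sequence of powers of [- mu] multiplies it by [- mu]; this is where the equation
     comes from. *)
  assert (e : ml_fun gamma (fun k => powers (Datatypes.S k)) t = - mu * ml_relax t).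
  { rewrite ml_relax_eq.
    apply (is_series_inj (V := R_NormedModule) _ _ _
      (ml_fun_correct gamma hgamma _ (geometrically_bounded_shift _ powers_bounded) t)).
    apply is_series_ext with (2 := is_series_scal (V := R_NormedModule) (- mu) _ _
      (ml_fun_correct gamma hgamma powers powers_bounded t)).
    intros k. unfold ml_coef, powers.
    change (- mu * (rpow t gamma ^ k * (/ Gamma (INR k * gamma + 1) * (- mu) ^ k)) =
      rpow t gamma ^ k * (/ Gamma (INR k * gamma + 1) * (- mu) ^ Datatypes.S k)).
    rewrite <- tech_pow_Rmult. ring. }
  rewrite e. change (Gamma (1 - gamma) * (- mu * ml_relax t) = - (mu * Gamma (1 - gamma) * ml_relax t)).
  ring.
Qed.

End Relaxation.

Lemma ml_relax_bounds gamma mu t : 0 < gamma < 1 -> 0 < mu -> 0 < t ->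
  / (1 + mu * Gamma (1 - gamma) * Rpower t gamma) <= ml_relax gamma mu t <= 1.
Proof.
intros hgamma hmu ht.
(* The horizon [t + 1] makes [t] an interior point. *)
assert (h := is_relaxation_ml gamma mu (t + 1) hgamma hmu).
assert (h0 := ml_relax_0 gamma mu hgamma hmu).
split.
- apply (relaxation_lower gamma mu (t + 1) hgamma hmu _ _ t h); lra.
- apply (relaxation_le gamma mu (t + 1) hgamma hmu _ _ t 1 h); lra.
Qed.

(** * Multipliers on a Hilbert space *)

Section Hilbert.

Variable H : CompleteNormedModule R_AbsRing.
Variable inner : H -> H -> R.
Hypothesis hinner : is_inner_product inner.

Lemma norm_sqr x : norm x ^ 2 = inner x x.
Proof.
rewrite (inner_norm hinner x). cbn [pow]. rewrite Rmult_1_r.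
apply sqrt_sqrt, (inner_pos hinner).
Qed.

Lemma inner_plus_r x y z : inner x (plus y z) = inner x y + inner x z.
Proof.
rewrite (inner_sym hinner x), (inner_plus_l hinner).
now rewrite (inner_sym hinner y), (inner_sym hinner z).
Qed.

Lemma inner_scal_r (a : R) x y : inner x (scal a y) = a * inner x y.
Proof. rewrite (inner_sym hinner x), (inner_scal_l hinner). now rewrite (inner_sym hinner y). Qed.

Lemma Cauchy_Schwarz x y : Rabs (inner x y) <= norm x * norm y.
Proof.
(* With [a], [c], [d] as named below, this square equals [c (a c - d^2)], which settles the case
   [c > 0]. *)
assert (h1 := inner_pos hinner (plus (scal (inner y y) x) (scal (- inner x y) y))).
rewrite (inner_plus_l hinner), !inner_plus_r, !(inner_scal_l hinner), !inner_scal_r,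
  (inner_sym hinner y x) in h1.
assert (hx := norm_sqr x). assert (hy := norm_sqr y).
assert (px := norm_ge_0 x). assert (py := norm_ge_0 y).
set (a := inner x x) in *. set (c := inner y y) in *. set (d := inner x y) in *.
assert (hd : d * d <= a * c).
{ destruct (Rle_lt_dec c 0) as [hc | hc].
  - assert (hc0 : c = 0) by (assert (h := inner_pos hinner y); fold c in h; lra).
    (* [inner (x + s y) (x + s y) = a + 2 s d >= 0] for every [s], so [d = 0] *)
    assert (h2 := inner_pos hinner (plus x (scal (- (a + 1) * / (2 * d)) y))).
    rewrite (inner_plus_l hinner), !inner_plus_r, !(inner_scal_l hinner), !inner_scal_r,
      (inner_sym hinner y x) in h2.
    fold a c d in h2. rewrite hc0 in h2 |- *.
    destruct (Req_dec d 0) as [-> | hd0]; [lra |].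
    replace (a + - (a + 1) * / (2 * d) * d +
      (- (a + 1) * / (2 * d) * d + - (a + 1) * / (2 * d) * (- (a + 1) * / (2 * d) * 0)))
      with (- 1) in h2 by (field; lra). lra.
  - apply Rmult_le_reg_l with c; auto. lra. }
apply Rsqr_incr_0_var; [| now apply Rmult_le_pos].
rewrite <- Rsqr_abs. unfold Rsqr.
replace (norm x * norm y * (norm x * norm y)) with (norm x ^ 2 * norm y ^ 2) by ring.
rewrite hx, hy. exact hd.
Qed.

Lemma is_linear_inner y : is_linear (fun x : H => inner x y : R_NormedModule).
Proof.
split.
- intros u v. apply (inner_plus_l hinner).
- intros k u. apply (inner_scal_l hinner).
- exists (norm y + 1). assert (hy := norm_ge_0 y). split; [lra |].
  intros u. change (Rabs (inner u y) <= (norm y + 1) * norm u).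
  apply Rle_trans with (1 := Cauchy_Schwarz u y).
  assert (hu := norm_ge_0 u). nra.
Qed.

Variable phi : nat -> H.
Hypothesis hphi : is_orthonormal_basis inner phi.

Lemma basis_expansion x : is_series (fun n => scal (inner x (phi n)) (phi n)) x.
Proof. apply hphi. Qed.

Lemma inner_scal_basis (a : R) n m :
  inner (scal a (phi n)) (phi m) = if Nat.eq_dec n m then a else 0.
Proof.
destruct hphi as [h1 [h2 _]]. rewrite (inner_scal_l hinner).
destruct (Nat.eq_dec n m) as [-> | hn].
- rewrite h1. ring.
- rewrite (h2 n m hn). ring.
Qed.

Lemma inner_series_basis (c : nat -> R) x m :
  is_series (fun n => scal (c n) (phi n)) x -> inner x (phi m) = c m.
Proof.
intros h.
assert (h1 := is_series_linear (V := R_NormedModule) _ (is_linear_inner (phi m)) _ _ h).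
cbn beta in h1.
assert (h0 : forall k, k <> m -> (inner (scal (c k) (phi k)) (phi m) : R_NormedModule) = zero).
{ intros k hk. rewrite inner_scal_basis. destruct (Nat.eq_dec k m); [lia | reflexivity]. }
assert (h2 := is_series_single (V := R_NormedModule) _ m h0).
rewrite (is_series_inj (V := R_NormedModule) _ _ _ h1 h2), inner_scal_basis.
destruct (Nat.eq_dec m m); [reflexivity | lia].
Qed.

Lemma basis_ext x y : (forall n, inner x (phi n) = inner y (phi n)) -> x = y.
Proof.
intros h. apply (is_series_inj (V := H) _ _ _ (basis_expansion x)).
apply is_series_ext with (2 := basis_expansion y). intros n. now rewrite h.
Qed.

Lemma Parseval x : is_series (fun n => inner x (phi n) ^ 2) (norm x ^ 2).
Proof.
rewrite norm_sqr.
assert (h := is_series_linear (V := R_NormedModule) _ (is_linear_inner x) _ _ (basis_expansion x)).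
apply is_series_ext with (2 := h). intros n.
rewrite (inner_scal_l hinner), (inner_sym hinner (phi n)). cbn [pow]. now rewrite Rmult_1_r.
Qed.

Lemma inner_sum_n_m_basis (c : nat -> R) n m k : (m < k)%nat ->
  inner (sum_n_m (fun j => scal (c j) (phi j)) n m) (phi k) = 0.
Proof.
intros hm.
assert (h0 : inner zero (phi k) = 0).
{ apply (linear_zero (V := R_NormedModule) _ (is_linear_inner (phi k))). }
induction m as [| m IH].
- destruct n as [| n].
  + rewrite sum_n_n, inner_scal_basis. destruct (Nat.eq_dec 0 k); [lia | reflexivity].
  + rewrite sum_n_m_zero by lia. exact h0.
- destruct (Nat.le_gt_cases n (S m)) as [hn | hn].
  + rewrite sum_n_Sm by auto. rewrite (inner_plus_l hinner), IH, inner_scal_basis by lia.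
    destruct (Nat.eq_dec (S m) k); [lia | ring].
  + rewrite sum_n_m_zero by lia. exact h0.
Qed.

Lemma norm_sum_n_m_basis (c : nat -> R) n m :
  norm (sum_n_m (fun j => scal (c j) (phi j)) n m) ^ 2 = sum_n_m (fun j => c j ^ 2) n m.
Proof.
rewrite norm_sqr.
assert (h0 : inner zero zero = 0).
{ apply (linear_zero (V := R_NormedModule) _ (is_linear_inner zero)). }
induction m as [| m IH].
- destruct n as [| n].
  + rewrite !sum_n_n, inner_scal_r, inner_scal_basis.
    destruct (Nat.eq_dec 0 0); [ring | lia].
  + rewrite !sum_n_m_zero by lia. exact h0.
- destruct (Nat.le_gt_cases n (S m)) as [hn | hn].
  + rewrite !sum_n_Sm by auto.
    rewrite (inner_plus_l hinner), !inner_plus_r, IH.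
    rewrite (inner_sym hinner (scal (c (S m)) (phi (S m))) (sum_n_m _ n m)).
    rewrite !inner_scal_r, !inner_sum_n_m_basis, inner_scal_basis by lia.
    destruct (Nat.eq_dec (S m) (S m)); [| lia].
    change (plus (sum_n_m (fun j => c j ^ 2) n m) (c (S m) ^ 2)) with
      (sum_n_m (fun j => c j ^ 2) n m + c (S m) ^ 2). ring.
  + rewrite !sum_n_m_zero by lia. exact h0.
Qed.

Lemma Riesz_Fischer (c : nat -> R) :
  ex_series (fun n => c n ^ 2) -> ex_series (fun n => scal (c n) (phi n)).
Proof.
intros h. apply (ex_series_Cauchy (V := H)). intros eps.
assert (he : 0 < eps * eps) by (apply Rmult_lt_0_compat; apply cond_pos).
destruct (Cauchy_ex_series (V := R_CompleteNormedModule) _ h (mkposreal _ he)) as [N hN].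
exists N. intros n m hn hm. specialize (hN n m hn hm).
change (Rabs (sum_n_m (fun j => c j ^ 2) n m) < eps * eps) in hN.
rewrite <- norm_sum_n_m_basis in hN.
assert (h1 := norm_ge_0 (sum_n_m (fun j => scal (c j) (phi j)) n m)).
assert (h2 := cond_pos eps).
rewrite Rabs_pos_eq in hN by apply pow2_ge_0. cbn [pow] in hN. rewrite Rmult_1_r in hN.
apply Rsqr_incrst_0; auto; lra.
Qed.

(** The diagonal operator with symbol [m], meaningful for bounded [m]. It serves for the recovery of
    the initial value, for the powers of [- A_alpha] and for the solution operator at a fixed
    time. *)
Definition multiplier (m : nat -> R) (x : H) : H :=
  iota (is_series (fun n => scal (m n * inner x (phi n)) (phi n))).

Section Multiplier.

Variables (m : nat -> R) (M : R) (x : H).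
Hypothesis hm : forall n, Rabs (m n) <= M.

Let sqr_le n : (m n * inner x (phi n)) ^ 2 <= M ^ 2 * inner x (phi n) ^ 2.
Proof.
rewrite Rpow_mult_distr. apply Rmult_le_compat_r; [apply pow2_ge_0 |].
rewrite <- (pow2_abs (m n)). apply pow_incr. split; [apply Rabs_pos | apply hm].
Qed.

Let series_bound : is_series (fun n => M ^ 2 * inner x (phi n) ^ 2) (M ^ 2 * norm x ^ 2).
Proof. exact (is_series_scal (V := R_NormedModule) (M ^ 2) _ _ (Parseval x)). Qed.

Let sqr_summable : ex_series (fun n => (m n * inner x (phi n)) ^ 2).
Proof.
apply (ex_series_le (V := R_CompleteNormedModule)) with
  (b := fun n => M ^ 2 * inner x (phi n) ^ 2).
- intros n. change (Rabs ((m n * inner x (phi n)) ^ 2) <= M ^ 2 * inner x (phi n) ^ 2).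
  rewrite Rabs_pos_eq by apply pow2_ge_0. apply sqr_le.
- eexists. exact series_bound.
Qed.

Lemma multiplier_correct : is_series (fun n => scal (m n * inner x (phi n)) (phi n)) (multiplier m x).
Proof.
destruct (Riesz_Fischer _ sqr_summable) as [l hl].
apply (iota_correct (is_series (fun n => scal (m n * inner x (phi n)) (phi n)))).
exists l. split; auto. intros l'. now apply (is_series_inj (V := H)).
Qed.

Lemma inner_multiplier n : inner (multiplier m x) (phi n) = m n * inner x (phi n).
Proof. exact (inner_series_basis _ _ n multiplier_correct). Qed.

Lemma diag_dom_bounded : diag_dom inner phi m x.
Proof.
destruct sqr_summable as [l hl]. exists l. apply is_series_ext with (2 := hl).
intros n. apply Rpow_mult_distr.
Qed.

Lemma norm_multiplier_le : norm (multiplier m x) <= M * norm x.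
Proof.
assert (hM : 0 <= M) by (apply Rle_trans with (2 := hm 0%nat); apply Rabs_pos).
assert (h1 := norm_series_le (V := R_NormedModule) _ _ _ _ (Parseval (multiplier m x)) series_bound).
assert (h2 : norm (multiplier m x) ^ 2 <= M ^ 2 * norm x ^ 2).
{ apply Rle_trans with (1 := Rle_abs _). apply h1. intros n.
  change (Rabs (inner (multiplier m x) (phi n) ^ 2) <= M ^ 2 * inner x (phi n) ^ 2).
  rewrite Rabs_pos_eq by apply pow2_ge_0. rewrite inner_multiplier. apply sqr_le. }
rewrite <- Rpow_mult_distr in h2. assert (hx := norm_ge_0 x).
apply Rsqr_incr_0_var; [| now apply Rmult_le_pos].
unfold Rsqr. cbn [pow] in h2. rewrite !Rmult_1_r in h2. exact h2.
Qed.

End Multiplier.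

End Hilbert.

(** In the variable [y = lambda n * alpha^(1 / b)] the upper bound becomes [y <= 1 + y^b]: for
    [y <= 1] the constant suffices, for [y > 1] the power does because [b >= 1]. *)
Lemma lambda_alpha_bounds (lambda : nat -> R) b alpha n :
  1 <= b -> 0 < alpha -> 0 < lambda n ->
  0 < lambda_alpha lambda b alpha n <= Rpower alpha (- (1 / b)).
Proof.
intros hb ha hl. unfold lambda_alpha. set (l := lambda n) in *.
assert (hp := Rpower_pos l b). assert (hq := Rpower_pos alpha (1 / b)).
assert (hd : 0 < 1 + alpha * Rpower l b) by nra.
split; [now apply Rdiv_lt_0_compat |].
set (y := l * Rpower alpha (1 / b)).
assert (hy0 : 0 < y) by now apply Rmult_lt_0_compat.
assert (hy : Rpower y b = alpha * Rpower l b).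
{ unfold y. rewrite <- Rpower_mult_distr, Rpower_mult by auto.
  replace (1 / b * b) with 1 by (field; lra). rewrite Rpower_1 by auto. ring. }
assert (h : y <= 1 + Rpower y b).
{ destruct (Rle_lt_dec y 1) as [h1 | h1].
  - assert (h := Rpower_pos y b). lra.
  - assert (h : Rpower y 1 <= Rpower y b) by (apply Rle_Rpower; lra).
    rewrite Rpower_1 in h by auto. lra. }
rewrite Rpower_Ropp. rewrite hy in h.
apply Rmult_le_reg_r with ((1 + alpha * Rpower l b) * Rpower alpha (1 / b));
  [now apply Rmult_lt_0_compat |].
replace (l / (1 + alpha * Rpower l b) * ((1 + alpha * Rpower l b) * Rpower alpha (1 / b)))
  with y by (unfold y; field; lra).
replace (/ Rpower alpha (1 / b) * ((1 + alpha * Rpower l b) * Rpower alpha (1 / b)))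
  with (1 + alpha * Rpower l b) by (field; lra).
exact h.
Qed.

(** * The final value problem *)

Lemma pos_of_increasing (lambda : nat -> R) :
  0 < lambda 0%nat -> (forall n, lambda n < lambda (S n)) -> forall n, 0 < lambda n.
Proof. intros h0 h n. induction n as [| n IH]; auto. specialize (h n). lra. Qed.

Section Final_value_problem.

Variables (gamma T b alpha : R).
Hypothesis hgamma : 0 < gamma < 1.
Hypothesis hT : 0 < T.
Hypothesis hb : 1 <= b.
Hypothesis halpha : 0 < alpha.
Variable H : CompleteNormedModule R_AbsRing.
Variable inner : H -> H -> R.
Hypothesis hinner : is_inner_product inner.
Variables (phi : nat -> H) (lambda : nat -> R).
Hypothesis hphi : is_orthonormal_basis inner phi.
Hypothesis hlam : forall n, 0 < lambda n.
Variable f : H.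

Let mu : nat -> R := lambda_alpha lambda b alpha.
Let M : R := Rpower alpha (- (1 / b)).
Let E (n : nat) (t : R) : R := ml_relax gamma (mu n) t.
(** A bound for [/ E n T] uniform in [n]: the lower bound for the Mittag-Leffler function with
    [mu n] replaced by its upper bound [M]. *)
Let K : R := 1 + M * (Gamma (1 - gamma) * Rpower T gamma).

Let hmu n : 0 < mu n <= M.
Proof. now apply lambda_alpha_bounds. Qed.

Let hGT : 0 < Gamma (1 - gamma) * Rpower T gamma.
Proof. apply Rmult_lt_0_compat; [apply Gamma_pos; lra | apply Rpower_pos]. Qed.

Let E_0 n : E n 0 = 1.
Proof. exact (ml_relax_0 gamma (mu n) hgamma (proj1 (hmu n))). Qed.

Let E_bounds n t : 0 <= t -> 0 < E n t <= 1.
Proof.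
intros [ht | <-]; [| rewrite E_0; lra].
assert (h := ml_relax_bounds gamma (mu n) t hgamma (proj1 (hmu n)) ht). fold (E n t) in h.
split; [| apply h]. apply Rlt_le_trans with (2 := proj1 h). apply Rinv_0_lt_compat.
assert (0 < mu n * Gamma (1 - gamma) * Rpower t gamma); [| lra].
apply Rmult_lt_0_compat; [| apply Rpower_pos].
apply Rmult_lt_0_compat; [exact (proj1 (hmu n)) | apply Gamma_pos; lra].
Qed.

Let inv_E_T n : 0 < / E n T <= K.
Proof.
assert (hE := E_bounds n T (Rlt_le _ _ hT)).
split; [now apply Rinv_0_lt_compat |].
assert (h := ml_relax_bounds gamma (mu n) T hgamma (proj1 (hmu n)) hT). fold (E n T) in h.
assert (hm := hmu n).
assert (h0 : 0 < mu n * Gamma (1 - gamma) * Rpower T gamma).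
{ rewrite Rmult_assoc. now apply Rmult_lt_0_compat. }
apply Rle_trans with (/ / (1 + mu n * Gamma (1 - gamma) * Rpower T gamma)).
- apply Rinv_le_contravar; [apply Rinv_0_lt_compat; lra | apply h].
- rewrite Rinv_inv. unfold K. rewrite Rmult_assoc. apply Rplus_le_compat_l.
  apply Rmult_le_compat_r; lra.
Qed.

Let E_ratio_bound n t : 0 <= t -> Rabs (E n t / E n T) <= K.
Proof.
intros ht. assert (h1 := E_bounds n t ht). assert (h2 := inv_E_T n).
unfold Rdiv. rewrite Rabs_pos_eq by nra. nra.
Qed.

Let inv_E_abs n : Rabs (/ E n T) <= K.
Proof. assert (h := inv_E_T n). rewrite Rabs_pos_eq; lra. Qed.

Let pow_mu_abs k n : Rabs ((- mu n) ^ k) <= M ^ k.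
Proof.
assert (h := hmu n). rewrite <- RPow_abs, Rabs_Ropp, Rabs_pos_eq by lra.
apply pow_incr. lra.
Qed.

(** The only possible initial value, since component [n] of the solution must be multiplied by
    [E n T] between time 0 and time [T]. It lies in [H] because [/ E n T] is bounded in [n]. *)
Let v0 : H := multiplier H inner phi (fun n => / E n T) f.

(** This is [(- A_alpha)^k v0], written as a single multiplier so that the factor [M^k] in its norm
    is read off the symbol. *)
Let c (k : nat) : H := multiplier H inner phi (fun n => (- mu n) ^ k) v0.

Let c_bounded : geometrically_bounded c.
Proof.
exists (norm v0), M. split; [apply norm_ge_0 |]. split; [left; apply Rpower_pos |].
intros k. rewrite Rmult_comm.
apply (norm_multiplier_le H inner hinner phi hphi _ _ v0 (pow_mu_abs k)).
Qed.

Let inner_c k n : inner (c k) (phi n) = (- mu n) ^ k * (inner f (phi n) / E n T).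
Proof.
unfold c. rewrite (inner_multiplier H inner hinner phi hphi _ _ v0 (pow_mu_abs k)).
unfold v0. rewrite (inner_multiplier H inner hinner phi hphi _ _ f inv_E_abs).
unfold Rdiv. ring.
Qed.

Definition fvp_solution : R -> H := ml_fun gamma c.

Let shifted_bounded := geometrically_bounded_shift c c_bounded.

(** Pairing the vector series with [phi n] leaves the scalar Mittag-Leffler series times [a]. It is
    stated for a general [d] in order to cover both [c] and its shift. *)
Let inner_ml (d : nat -> H) (hd : geometrically_bounded d) n a t :
  (forall k, inner (d k) (phi n) = (- mu n) ^ k * a) ->
  inner (ml_fun gamma d t) (phi n) = E n t * a.
Proof.
intros h.
assert (h1 := is_series_linear (V := R_NormedModule) _ (is_linear_inner H inner hinner (phi n))
  _ _ (ml_fun_correct gamma hgamma d hd t)).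
assert (hp : geometrically_bounded (V := R_CompleteNormedModule) (fun k => (- mu n) ^ k)).
{ exists 1, M. split; [lra |]. split; [left; apply Rpower_pos |].
  intros k. rewrite Rmult_1_l. apply (pow_mu_abs k n). }
assert (h2 := is_series_scal (V := R_NormedModule) a _ _ (ml_fun_correct gamma hgamma _ hp t)).
unfold E. rewrite (ml_relax_eq gamma (mu n) hgamma (proj1 (hmu n))), Rmult_comm.
apply (is_series_inj (V := R_NormedModule) _ _ _ h1).
apply is_series_ext with (2 := h2). intros k. unfold ml_coef.
rewrite !(inner_scal_l hinner), h.
change (a * (rpow t gamma ^ k * (/ Gamma (INR k * gamma + 1) * (- mu n) ^ k)) =
  rpow t gamma ^ k * (/ Gamma (INR k * gamma + 1) * ((- mu n) ^ k * a))). ring.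
Qed.

Let inner_solution n t : inner (fvp_solution t) (phi n) = E n t * (inner f (phi n) / E n T).
Proof. apply inner_ml; auto. Qed.

Let inner_shifted n t :
  inner (ml_fun gamma (fun k => c (S k)) t) (phi n) = - mu n * inner (fvp_solution t) (phi n).
Proof.
rewrite inner_solution.
replace (- mu n * (E n t * (inner f (phi n) / E n T))) with
  (E n t * (- mu n * (inner f (phi n) / E n T))) by ring.
apply inner_ml; auto. intros k. rewrite inner_c, <- tech_pow_Rmult. ring.
Qed.

Lemma fvp_solution_series t : is_series
  (fun n => scal (mittag_leffler gamma 1 (- mu n * rpow t gamma) * inner f (phi n)
     / mittag_leffler gamma 1 (- mu n * rpow T gamma)) (phi n)) (fvp_solution t).
Proof.
apply is_series_ext with (2 := basis_expansion H inner phi hphi (fvp_solution t)).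
intros n. apply (f_equal (fun a => scal (a : R) (phi n))).
rewrite inner_solution. unfold E, ml_relax, Rdiv. ring.
Qed.

(** The power series bounded term by term would lose the alternating signs. Seen as the multiplier
    with symbol [E n t / E n T] applied to [f], the solution inherits the bound on the symbol, where
    the numerator is at most 1. *)
Lemma fvp_solution_bound t : 0 <= t -> norm (fvp_solution t) <= K * norm f.
Proof.
intros ht.
replace (fvp_solution t) with (multiplier H inner phi (fun n => E n t / E n T) f).
- apply (norm_multiplier_le H inner hinner phi hphi). intros n. now apply E_ratio_bound.
- apply (basis_ext H inner phi hphi). intros n.
  rewrite (inner_multiplier H inner hinner phi hphi _ K) by (intros; now apply E_ratio_bound).
  rewrite inner_solution. unfold Rdiv. ring.
Qed.

Lemma fvp_solution_correct : is_solution inner phi lambda gamma T b alpha f fvp_solution.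
Proof.
split; [| split].
- intros t _ P hP. apply (filter_le_within (F := locally t)).
  exact (continuous_ml_fun gamma hgamma c c_bounded t P hP).
- exists (ml_fun_derive gamma c). split.
  + intros t ht. split.
    * apply (is_derive_ml_fun gamma hgamma c c_bounded). lra.
    * apply (continuous_ml_fun_derive gamma hgamma c c_bounded). lra.
  + intros t ht. fold mu. split.
    { apply (diag_dom_bounded H inner hinner phi hphi mu M (fvp_solution t)).
      intros n. assert (h := hmu n). rewrite Rabs_pos_eq; lra. }
    (* The shift multiplies component [n] by [- mu n], so the shifted series is [- A_alpha v]; it is
       also the Caputo derivative. *)
    exists (ml_fun gamma (fun k => c (S k)) t), (opp (ml_fun gamma (fun k => c (S k)) t)).
    split; [| split].
    * exists (scal (Gamma (1 - gamma)) (ml_fun gamma (fun k => c (S k)) t)). split.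
      -- apply (ml_fun_caputo gamma hgamma c c_bounded t (proj1 ht)).
      -- rewrite scal_assoc. symmetry. etransitivity; [| apply (scal_one (V := H))].
         apply (f_equal (fun a => scal (a : R) _)). apply Rinv_l.
         assert (h := Gamma_pos (1 - gamma) ltac:(lra)). lra.
    * apply is_series_ext with (2 := basis_expansion H inner phi hphi _).
      intros n. apply (f_equal (fun a => scal (a : R) (phi n))).
      assert (e : inner (opp (ml_fun gamma (fun k => c (S k)) t)) (phi n) =
        - inner (ml_fun gamma (fun k => c (S k)) t) (phi n)).
      { replace (opp (ml_fun gamma (fun k => c (S k)) t)) with
          (scal (- (1)) (ml_fun gamma (fun k => c (S k)) t))
          by apply (scal_opp_one (K := R_AbsRing) (V := H)).
        rewrite (inner_scal_l hinner). ring. }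
      rewrite e, inner_shifted. ring.
    * apply (plus_opp_r (G := H)).
- apply (basis_ext H inner phi hphi). intros n. rewrite inner_solution.
  assert (h := E_bounds n T (Rlt_le _ _ hT)). field. lra.
Qed.

(** * Uniqueness, one eigendirection at a time *)

Section Uniqueness.

Variable w : R -> H.
Hypothesis hw : is_solution inner phi lambda gamma T b alpha f w.

Let component (n : nat) (t : R) : R := inner (w t) (phi n).

Let continuous_component n t : 0 <= t <= T ->
  filterlim (component n) (within (fun s => 0 <= s <= T) (locally t)) (locally (component n t)).
Proof.
intros ht. destruct hw as [hcont _].
apply (filterlim_comp _ _ _ w (fun x => inner x (phi n) : R_NormedModule) _ (locally (w t))).
- exact (hcont t ht).
- exact (linear_cont _ (w t) (is_linear_inner H inner hinner (phi n))).
Qed.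

(** Pairing with [phi n] is bounded and linear, hence commutes with the derivative and with the
    improper integral, and it turns [A_alpha] into multiplication by [mu n]. *)
Let component_relaxation n : exists dz, is_relaxation gamma (mu n) T (component n) dz.
Proof.
destruct hw as [_ [[dw [hC1 heq]] _]].
assert (hlin := is_linear_inner H inner hinner (phi n)).
exists (fun t => inner (dw t) (phi n)). split.
- intros P hP. destruct (continuous_component n 0 ltac:(lra) P hP) as [d hd].
  (* The minimum with [T] keeps [s] inside [[0, T]], the set relative to which [w] is continuous. *)
  exists (mkposreal (Rmin d T) (Rmin_pos _ _ (cond_pos d) hT)). intros s hs hs0.
  change (Rabs (s - 0) < Rmin d T) in hs. apply hd.
  + apply Rlt_le_trans with (1 := hs). apply Rmin_l.
  + assert (h := Rlt_le_trans _ _ _ hs (Rmin_r _ _)).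
    rewrite Rminus_0_r, Rabs_pos_eq in h; lra.
- intros t ht. apply (is_derive_linear (V := R_NormedModule) _ hlin). apply (hC1 t ht).
- intros t ht. apply (filterlim_comp _ _ _ dw (fun x => inner x (phi n) : R_NormedModule) _ (locally (dw t))).
  + apply (hC1 t ht).
  + exact (linear_cont _ (dw t) hlin).
- intros t ht.
  destruct (heq t ht) as [_ [d [Aw [[l [[_ hl] hd]] [hA hdA]]]]].
  assert (HI := improper_interval_bounded 0 t (proj1 ht)).
  assert (PFa := ii_left_proper HI). assert (PFb := ii_right_proper HI).
  assert (g := is_RInt_gen_linear (V := R_NormedModule) _ hlin _ _ _ _ hl).
  assert (hGpos := Gamma_pos (1 - gamma) ltac:(lra)).
  replace (- (mu n * Gamma (1 - gamma) * component n t)) with (inner l (phi n)).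
  + apply (is_RInt_gen_ext_on HI (V := R_CompleteNormedModule)) with (2 := g).
    intros s _. apply (inner_scal_l hinner).
  + assert (e1 : inner d (phi n) = / Gamma (1 - gamma) * inner l (phi n)).
    { rewrite hd. apply (inner_scal_l hinner). }
    assert (e2 : inner Aw (phi n) = mu n * component n t).
    { exact (inner_series_basis H inner hinner phi hphi _ _ n hA). }
    assert (e3 : inner d (phi n) + inner Aw (phi n) = 0).
    { rewrite <- (inner_plus_l hinner), hdA.
      apply (linear_zero (V := R_NormedModule) _ hlin). }
    rewrite e1, e2 in e3.
    apply Rmult_eq_reg_l with (/ Gamma (1 - gamma)); [| apply Rinv_neq_0_compat; lra].
    replace (/ Gamma (1 - gamma) * - (mu n * Gamma (1 - gamma) * component n t)) with
      (- (mu n * component n t)) by (field; lra). lra.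
Qed.

(** The function [component n 0 * E n], encoded as a combination with second coefficient 0, solves
    the same scalar equation from the same initial value, because [E n 0 = 1]. *)
Let component_initial n t : 0 <= t < T -> component n t = component n 0 * E n t.
Proof.
intros ht. destruct (component_relaxation n) as [dz hz].
assert (hE := is_relaxation_ml gamma (mu n) T hgamma (proj1 (hmu n))).
assert (h := relaxation_unique gamma (mu n) T hgamma (proj1 (hmu n)) _ _ _ _ t hz
  (is_relaxation_lin _ _ _ _ _ _ _ (component n 0) 0 hE hE)).
cbn beta in h. fold (E n t) (E n 0) in h. rewrite E_0 in h.
rewrite h; auto; lra.
Qed.

(** The equation stops short of [T], where the data are given; the identity is carried to [T] by
    comparing left limits. *)
Let component_formula n t : 0 <= t <= T -> component n t = component n 0 * E n t.
Proof.
intros ht. destruct (Rle_lt_or_eq_dec _ _ (proj2 ht)) as [hlt | ->]; [apply component_initial; lra |].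
assert (PF := at_left_proper_filter T).
apply (filterlim_locally_unique (F := at_left T) (V := R_NormedModule) (component n)).
- intros P hP. destruct (continuous_component n T ltac:(lra) P hP) as [d hd].
  exists (mkposreal (Rmin d T) (Rmin_pos _ _ (cond_pos d) hT)). intros s hs hs0.
  change (Rabs (s - T) < Rmin d T) in hs. apply hd.
  + apply Rlt_le_trans with (1 := hs). apply Rmin_l.
  + assert (h := Rlt_le_trans _ _ _ hs (Rmin_r _ _)). apply Rabs_def2 in h. lra.
- apply filterlim_ext_loc with (fun s => component n 0 * E n s).
  + generalize (ii_right (improper_interval_bounded 0 T hT)). apply filter_imp.
    intros s hs. symmetry. apply component_initial. lra.
  + apply (filterlim_comp _ _ _ (E n) (fun r => component n 0 * r) _ (locally (E n T))).
    (* A horizon beyond [T] gives differentiability, hence continuity, of [E n] at [T] itself. *)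
    * assert (hE := is_relaxation_ml gamma (mu n) (T + 1) hgamma (proj1 (hmu n))).
      intros P hP. apply (filter_le_within (F := locally T)).
      refine (ex_derive_continuous (V := R_NormedModule) (E n) T _ P hP).
      eexists. apply (relax_derive _ _ _ _ _ hE). lra.
    * apply (filterlim_scal_r (V := R_NormedModule)).
Qed.

(** The final condition reads [component n 0 * E n T = inner f (phi n)], and positivity of [E n T]
    determines the initial component. *)
Lemma fvp_solution_unique t : 0 <= t <= T -> w t = fvp_solution t.
Proof.
intros ht. apply (basis_ext H inner phi hphi). intros n. rewrite inner_solution.
change (component n t = E n t * (inner f (phi n) / E n T)).
assert (hTn := component_formula n T ltac:(lra)).
assert (e : component n T = inner f (phi n)).
{ destruct hw as [_ [_ hwT]]. unfold component. now rewrite hwT. }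
rewrite component_formula, <- e, hTn by auto.
assert (h := E_bounds n T (Rlt_le _ _ hT)). field. lra.
Qed.

End Uniqueness.

End Final_value_problem.

Theorem lemma6
  (gamma T b : R) (hgamma : 0 < gamma < 1) (hT : 0 < T) (hb : 1 <= b)
  (H : CompleteNormedModule R_AbsRing) (inner : H -> H -> R)
  (hinner : is_inner_product inner)
  (D : H -> Prop) (A : H -> H)
  (hA : is_operator D A)
  (hAsa : is_self_adjoint inner D A)
  (hAcl : is_closed_operator D A)
  (hAgen : exists S : R -> H -> H,
     is_C0_semigroup S /\ is_contraction_semigroup S /\
     is_compact_semigroup S /\ is_generator S D (fun x => opp (A x)))
  (phi : nat -> H) (lambda : nat -> R)
  (hphi : is_orthonormal_basis inner phi)
  (heig : forall n, D (phi n) /\ A (phi n) = scal (lambda n) (phi n))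
  (hlam0 : 0 < lambda 0%nat)
  (hlam : forall n, lambda n < lambda (S n))
  (hlaminf : is_lim_seq lambda p_infty) :
  exists C6 : R, forall (alpha : R) (f : H), 0 < alpha ->
    exists v : R -> H,
      is_solution inner phi lambda gamma T b alpha f v /\
      (forall w : R -> H,
         is_solution inner phi lambda gamma T b alpha f w ->
         forall t, 0 <= t <= T -> w t = v t) /\
      (forall t, 0 <= t <= T ->
         is_series
           (fun n =>
              scal (mittag_leffler gamma 1
                      (- lambda_alpha lambda b alpha n * rpow t gamma)
                    * inner f (phi n)
                    / mittag_leffler gamma 1
                        (- lambda_alpha lambda b alpha n * rpow T gamma))
                   (phi n))
           (v t)) /\
      (forall t, 0 <= t <= T ->
         norm (v t) <= C6 * (1 + Rpower alpha (- (1 / b))) * norm f).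
Proof.
assert (hpos := pos_of_increasing lambda hlam0 hlam).
assert (hGT : 0 < Gamma (1 - gamma) * Rpower T gamma).
{ apply Rmult_lt_0_compat; [apply Gamma_pos; lra | apply Rpower_pos]. }
(* With [g = Gamma (1 - gamma) * T^gamma] and [M = alpha^(- 1 / b)], the bound [1 + M g] is at most
   [(1 + g) (1 + M)]; the first factor depends neither on [alpha] nor on [f]. *)
exists (1 + Gamma (1 - gamma) * Rpower T gamma). intros alpha f halpha.
exists (fvp_solution gamma T b alpha H inner phi lambda f).
split; [| split; [| split]].
- now apply fvp_solution_correct.
- intros w hw t ht. now apply fvp_solution_unique.
- intros t ht. now apply fvp_solution_series.
- intros t ht. assert (hM := Rpower_pos alpha (- (1 / b))).
  eapply Rle_trans; [now apply fvp_solution_bound |].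
  apply Rmult_le_compat_r; [apply norm_ge_0 |]. nra.
Qed.
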